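(* Let $f(z) = z + a_2 z^2 + a_3 z^3 + \cdots$ belong to $\mathcal{S}_e^{\ast}$, with $\gamma_1=\frac12 a_2$ real. Then $$-\frac{1}{16}\le T_{2,1}\!\left(F_f/\gamma\right)\le\frac{15}{64},$$ where $T_{2,1}(F_f/\gamma)=\gamma_1^2-|\gamma_2|^2$. Both inequalities are sharp, i.e. each is attained with equality by some such function $f$.
   Context: $\mathbb{D}=\{z\in\mathbb{C}:|z|<1\}$. $\mathcal{S}$ is the class of univalent analytic functions $f$ on $\mathbb{D}$ with $f(0)=0$, $f'(0)=1$, written $f(z)=z+\sum_{n\ge2}a_nz^n$. For analytic $g,h$ on $\mathbb{D}$, $g\prec h$ (subordination) means that there is an analytic $\omega:\mathbb{D}\to\mathbb{D}$ with $\omega(0)=0$ and $g(z)=h(\omega(z))$ for $z\in\mathbb{D}$. The class $\mathcal{S}_e^{\ast}$ is $$\mathcal{S}_e^{\ast}=\left\{f\in\mathcal{S}:\ \frac{zf'(z)}{f(z)}\prec e^z,\ z\in\mathbb{D}\right\}.$$ The logarithmic coefficients $\gamma_n$ of $f\in\mathcal{S}$ are defined by $F_f(z)=\log\frac{f(z)}{z}=2\sum_{n=1}^\infty\gamma_nz^n$, with $\log1=0$; thus $\gamma_1=\frac12a_2$ and $\gamma_2=\frac12\left(a_3-\frac12a_2^2\right)$. The second-order Hermitian-Toeplitz determinant of the logarithmic coefficients is $T_{2,1}(F_f/\gamma)=\gamma_1^2-|\gamma_2|^2=\frac1{16}\left(-a_2^4+4a_2^2+4a_2^2\operatorname{Re}(a_3)-4|a_3|^2\right)$,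 where the diagonal entry $\gamma_1$ of the Hermitian-Toeplitz matrix is real. *)

(* Defs.v *)
From Stdlib Require Import Reals.
From Coquelicot Require Import Coquelicot.

Open Scope R_scope.

Definition in_disc (z : C) : Prop := Cmod z < 1.

Definition Cexp (z : C) : C := (exp (Re z) * cos (Im z), exp (Re z) * sin (Im z)).

Definition analytic_on_disc (f : C -> C) : Prop :=
  forall z : C, in_disc z -> @ex_derive C_AbsRing C_NormedModule f z.

Definition univalent_on_disc (f : C -> C) : Prop :=
  forall z w : C, in_disc z -> in_disc w -> f z = f w -> z = w.

Definition class_S (f : C -> C) : Prop :=
  analytic_on_disc f /\ univalent_on_disc f /\
  f (RtoC 0) = RtoC 0 /\ C_derive f (RtoC 0) = RtoC 1.

Definition subordinate (g h : C -> C) : Prop :=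
  exists omega : C -> C,
    analytic_on_disc omega /\
    (forall z : C, in_disc z -> in_disc (omega z)) /\
    omega (RtoC 0) = RtoC 0 /\
    (forall z : C, in_disc z -> g z = h (omega z)).

(* z f'(z) / f(z); for f in S the singularity at 0 is removable with value 1,
   whereas the totalized division would give 0 there. *)
Definition log_deriv_quotient (f : C -> C) (z : C) : C :=
  if Ceq_dec z (RtoC 0) then RtoC 1 else (z * C_derive f z / f z)%C.

Definition class_S_e (f : C -> C) : Prop :=
  class_S f /\ subordinate (log_deriv_quotient f) Cexp.

(* F is the analytic branch of log (f(z)/z) with F(0) = 0 (i.e. log 1 = 0),
   and F(z) = 2 * sum_{n >= 1} gamma_n z^n on the disc; gamma 0 plays no role. *)
Definition log_coefficients (f : C -> C) (gamma : nat -> C) : Prop :=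
  exists F : C -> C,
    analytic_on_disc F /\
    F (RtoC 0) = RtoC 0 /\
    (forall z : C, in_disc z -> z <> RtoC 0 -> Cexp (F z) = (f z / z)%C) /\
    (forall z : C, in_disc z ->
       @is_series C_AbsRing C_NormedModule
         (fun n : nat => (RtoC 2 * (gamma (S n) * Cpow z (S n)))%C) (F z)).

(* Determinant of the Hermitian-Toeplitz matrix
   [[gamma_1, gamma_2], [conj gamma_2, gamma_1]], whose diagonal entry
   gamma_1 is assumed real; hence the real part. *)
Definition T21 (gamma : nat -> C) : R :=
  Re (gamma 1%nat) ^ 2 - Cmod (gamma 2%nat) ^ 2.

(* Main.v *)
Require Import Defs.
From Stdlib Require Import Reals Factorial Lra Lia.
From Coquelicot Require Import Coquelicot.

Open Scope R_scope.

(** Write [z f'(z) / f(z) = Cexp (omega z)] with a Schwarz function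
    [omega z = c z + d z^2 + ...], and let [F] be the branch of [log (f(z)/z)]
    with [F 0 = 0].  Since [f = z Cexp F], one has
    [1 + z F'(z) = Cexp (omega z)], and comparison of coefficients gives
    [c = 2 gamma_1] and [d = 4 gamma_2 - 2 gamma_1^2].  The Schwarz-Pick inequality
    [|d| <= 1 - |c|^2] then confines [4 gamma_2] to the disc of centre [t/2] and
    radius [1 - t], where [t = 4 gamma_1^2] lies in [[0, 1]].  Hence
    [3t/2 - 1 <= 4 |gamma_2| <= 1 - t/2], and both bounds for
    [t/4 - |gamma_2|^2] follow by elementary algebra ([T21_bounds]).

    The inequality [|d| <= 1 - |c|^2] ([schwarz_pick_coefficients]) is obtained
    from Fourier coefficients: multiplication by a function bounded by 1 does not
    increase the mean square over a circle, so the Toeplitz matrix with rows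
    [(c, 0)] and [(d, c)] is a contraction.  This uses the means of
    [omega], [omega / z] and [omega / z^2] over the circles [|z| = r].  In the
    coordinate [zeta = log z] these are integrals over a period of a holomorphic
    [2 pi i]-periodic function; such an integral is independent of [Re zeta],
    because its derivative is the integral of a derivative along the period
    ([RInt_Re_vertical_period]).  Differentiating under the integral needs [omega']
    to be continuous, and this holds because [omega' = p' Cexp (- omega)], where
    [p = 1 + z F'] is a power series.

    Equality is attained for [omega z = z^2] (lower bound) and [omega z = z]
    (upper bound).  The corresponding functions are [z Cexp (L (z^2) / 2)] and
    [z Cexp (L z)] with [L z = sum z^n / (n n!)].  Their univalence
    ([starlike_univalent]) is seen in the logarithmic coordinate too:
    [zeta + F (Cexp zeta)] has a derivative with positive real part on the left
    half-plane, which is convex, so it is injective there. *)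


(** * Complex derivatives *)

(** The module over itself given by [AbsRing_NormedModule] is the target for which
    product and chain rules are available; [C_NormedModule] has the same norm but
    another uniform structure, and [cder_C_NormedModule] passes between the two. *)
Definition cder (f : C -> C) (z l : C) : Prop :=
  @is_derive C_AbsRing (AbsRing_NormedModule C_AbsRing) f z l.

Lemma cder_C_NormedModule (f : C -> C) (z l : C) :
  cder f z l <-> @is_derive C_AbsRing C_NormedModule f z l.
Proof.
  split; intros [[H1 H2 H3] H]; (split; [split; assumption | exact H]).
Qed.

(** The form in which differentiability is checked from an explicit Taylor bound,
    both for the exponential and for power series. *)
Lemma cder_of_quadratic_remainder (f : C -> C) (z l : C) (K delta : R) :
  0 < delta ->
  (forall w, Cmod (w - z)%C < delta ->
     Cmod (f w - f z - l * (w - z))%C <= K * Cmod (w - z)%C ^ 2) ->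
  cder f z l.
Proof.
  intros Hd HK. split; [apply is_linear_scal_l|].
  intros x Hx eps.
  assert (E : z = x)
    by exact (is_filter_lim_locally_unique (K := C_AbsRing)
                (V := AbsRing_NormedModule C_AbsRing) z x Hx).
  subst x.
  pose proof (Rle_abs K) as HKa. pose proof (Rabs_pos K) as HKp.
  assert (He : 0 < Rmin delta (eps / (Rabs K + 1))).
  { apply Rmin_pos; [lra|]. apply Rdiv_lt_0_compat; [apply cond_pos|lra]. }
  exists (mkposreal _ He). intros w Hw. change (Cmod (w - z)%C < Rmin delta (eps / (Rabs K + 1))) in Hw.
  change (Cmod (f w - f z - (w - z) * l)%C <= eps * Cmod (w - z)%C).
  rewrite (Cmult_comm _ l).
  pose proof (Rmin_l delta (eps / (Rabs K + 1))). pose proof (Rmin_r delta (eps / (Rabs K + 1))).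
  eapply Rle_trans; [apply HK; lra|].
  pose proof (Cmod_ge_0 (w - z)%C) as Hp.
  assert (H2 : (Rabs K + 1) * Cmod (w - z)%C <= eps).
  { apply Rle_trans with ((Rabs K + 1) * (eps / (Rabs K + 1))).
    - apply Rmult_le_compat_l; lra.
    - right; field; lra. }
  simpl. rewrite Rmult_1_r.
  rewrite <- Rmult_assoc. apply Rmult_le_compat_r; nra.
Qed.

Lemma cder_const (a z : C) : cder (fun _ => a) z 0.
Proof. exact (@is_derive_const C_AbsRing (AbsRing_NormedModule C_AbsRing) a z). Qed.

Lemma cder_id (z : C) : cder (fun w => w) z 1.
Proof. exact (@is_derive_id C_AbsRing z). Qed.

Lemma cder_eq (f : C -> C) (z l m : C) : cder f z l -> l = m -> cder f z m.
Proof. intros H <-; exact H. Qed.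

Lemma cder_plus (f g : C -> C) (z l m : C) :
  cder f z l -> cder g z m -> cder (fun w => f w + g w)%C z (l + m)%C.
Proof. exact (@is_derive_plus C_AbsRing (AbsRing_NormedModule C_AbsRing) f g z l m). Qed.

Lemma cder_opp (f : C -> C) (z l : C) : cder f z l -> cder (fun w => - f w)%C z (- l)%C.
Proof. exact (@is_derive_opp C_AbsRing (AbsRing_NormedModule C_AbsRing) f z l). Qed.

Lemma cder_ext (f g : C -> C) (z l : C) : (forall w, f w = g w) -> cder f z l -> cder g z l.
Proof. exact (@is_derive_ext C_AbsRing (AbsRing_NormedModule C_AbsRing) f g z l). Qed.

Lemma cder_mult (f g : C -> C) (z l m : C) :
  cder f z l -> cder g z m ->
  cder (fun w => f w * g w)%C z (l * g z + f z * m)%C.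
Proof.
  intros Hf Hg. exact (@is_derive_mult C_AbsRing f g z l m Hf Hg Cmult_comm).
Qed.

Lemma cder_scal (a : C) (f : C -> C) (z l : C) :
  cder f z l -> cder (fun w => a * f w)%C z (a * l)%C.
Proof.
  intros H. eapply cder_eq; [apply (cder_mult (fun _ => a) f); [apply cder_const|exact H]|].
  ring.
Qed.

Lemma cder_comp (f g : C -> C) (z l m : C) :
  cder f (g z) l -> cder g z m -> cder (fun w => f (g w)) z (l * m)%C.
Proof.
  intros Hf Hg. eapply cder_eq.
  - exact (@is_derive_comp C_AbsRing (AbsRing_NormedModule C_AbsRing) f g z l m Hf Hg).
  - apply Cmult_comm.
Qed.

Lemma cder_continuous (f : C -> C) (z l : C) (eps : R) :
  cder f z l -> 0 < eps ->
  exists delta, 0 < delta /\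
    forall w, Cmod (w - z)%C < delta -> Cmod (f w - f z)%C < eps.
Proof.
  intros Hf He.
  assert (Hc : @continuous (AbsRing_UniformSpace C_AbsRing) (AbsRing_UniformSpace C_AbsRing) f z)
    by (apply (ex_derive_continuous (K := C_AbsRing) (V := AbsRing_NormedModule C_AbsRing)); exists l; exact Hf).
  pose proof (proj1 (filterlim_locally _ _) Hc) as H. destruct (H (mkposreal eps He)) as [d Hd].
  exists d. split; [apply cond_pos|]. intros w Hw. apply (Hd w Hw).
Qed.

Lemma cder_remainder (f : C -> C) (z l : C) (eps : R) :
  cder f z l -> 0 < eps ->
  exists delta, 0 < delta /\
    forall w, Cmod (w - z)%C < delta ->
      Cmod (f w - f z - l * (w - z))%C <= eps * Cmod (w - z)%C.
Proof.
  intros [_ Hf] He.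
  destruct (Hf z (fun P H => H) (mkposreal eps He)) as [d Hd].
  exists d. split; [apply cond_pos|]. intros w Hw.
  rewrite (Cmult_comm l). apply (Hd w Hw).
Qed.

Lemma cder_unique (f : C -> C) (z l m : C) : cder f z l -> cder f z m -> l = m.
Proof.
  intros Hl Hm.
  rewrite <- (is_C_derive_unique f z l) by (apply cder_C_NormedModule, Hl).
  apply is_C_derive_unique, cder_C_NormedModule, Hm.
Qed.

Lemma in_disc_open (z : C) : in_disc z ->
  forall w, Cmod (w - z)%C < 1 - Cmod z -> in_disc w.
Proof.
  intros Hz w Hw. unfold in_disc in *.
  replace w with ((w - z) + z)%C by ring.
  eapply Rle_lt_trans; [apply Cmod_triangle|lra].
Qed.

Lemma cder_ext_disc (f g : C -> C) (z l : C) :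
  in_disc z -> (forall w, in_disc w -> f w = g w) -> cder f z l -> cder g z l.
Proof.
  intros Hz E. apply is_derive_ext_loc.
  assert (H : 0 < 1 - Cmod z) by (unfold in_disc in Hz; lra).
  exists (mkposreal _ H). intros w Hw. apply E. exact (in_disc_open z Hz w Hw).
Qed.

(** * The complex exponential *)

Lemma Cexp_plus (z w : C) : Cexp (z + w) = (Cexp z * Cexp w)%C.
Proof.
  unfold Cexp, Cmult, Cplus, Re, Im; destruct z as [a b], w as [c d]; simpl.
  rewrite exp_plus, cos_plus, sin_plus. f_equal; ring.
Qed.

Lemma Cexp_0 : Cexp 0 = 1.
Proof. unfold Cexp; simpl. rewrite exp_0, cos_0, sin_0. unfold RtoC; f_equal; ring. Qed.

Lemma Cexp_opp (z : C) : (Cexp z * Cexp (- z))%C = 1.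
Proof. rewrite <- Cexp_plus. replace (z + - z)%C with (RtoC 0) by ring. apply Cexp_0. Qed.

Lemma Cexp_neq_0 (z : C) : Cexp z <> 0.
Proof.
  intros H. pose proof (Cexp_opp z) as E. rewrite H, Cmult_0_l in E.
  injection E; lra.
Qed.

Lemma Cmod_Cexp (z : C) : Cmod (Cexp z) = exp (Re z).
Proof.
  unfold Cmod, Cexp; simpl.
  replace (exp (Re z) * cos (Im z) * (exp (Re z) * cos (Im z) * 1) +
     exp (Re z) * sin (Im z) * (exp (Re z) * sin (Im z) * 1))
    with (exp (Re z) ^ 2 * (Rsqr (sin (Im z)) + Rsqr (cos (Im z)))) by (unfold Rsqr; ring).
  rewrite sin2_cos2, Rmult_1_r. apply sqrt_pow2. left; apply exp_pos.
Qed.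

Lemma Cmod_le_parts (z : C) : Cmod z <= Rabs (Re z) + Rabs (Im z).
Proof.
  destruct z as [x y].
  replace ((x, y) : C) with (RtoC x + Ci * RtoC y)%C
    by (unfold RtoC, Ci, Cplus, Cmult; simpl; f_equal; ring).
  eapply Rle_trans; [apply Cmod_triangle|].
  rewrite Cmod_mult, Cmod_Ci, !Cmod_R. simpl.
  right. f_equal; [|rewrite Rmult_1_l]; f_equal; ring.
Qed.

Lemma im_le_Cmod (z : C) : Rabs (Im z) <= Cmod z.
Proof. eapply Rle_trans; [|apply Rmax_Cmod]. apply Rmax_r. Qed.

Lemma exp_remainder (x : R) : Rabs x <= 1 / 2 -> Rabs (exp x - 1 - x) <= 2 * x ^ 2.
Proof.
  intros Hx. apply Rabs_le_between in Hx.
  pose proof (exp_ineq1_le x) as H1. pose proof (exp_ineq1_le (- x)) as H2.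
  rewrite Rabs_right by lra.
  assert (H3 : exp x * (1 - x) <= 1).
  { apply Rle_trans with (exp x * exp (- x)).
    - apply Rmult_le_compat_l; [left; apply exp_pos|lra].
    - rewrite <- exp_plus, Rplus_opp_r, exp_0. lra. }
  pose proof (exp_pos x). nra.
Qed.

Lemma Rabs_sin_le (x : R) : Rabs (sin x) <= Rabs x.
Proof.
  destruct (MVT_gen sin 0 x cos) as [c [_ Hc]].
  - intros; auto_derive; [easy|ring].
  - intros; apply continuity_sin.
  - rewrite sin_0, !Rminus_0_r in Hc. rewrite Hc, Rabs_mult.
    pose proof (COS_bound c). pose proof (Rabs_pos x).
    assert (Rabs (cos c) <= 1) by (apply Rabs_le; lra). nra.
Qed.

Lemma cos_remainder (x : R) : Rabs (cos x - 1) <= x ^ 2.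
Proof.
  replace x with (2 * (x / 2)) at 1 by field. rewrite cos_2a_sin.
  pose proof (Rabs_sin_le (x / 2)) as H.
  apply Rsqr_le_abs_1 in H. unfold Rsqr in H.
  apply Rabs_le. nra.
Qed.

Lemma sin_remainder (x : R) : Rabs x <= 1 -> Rabs (sin x - x) <= x ^ 2.
Proof.
  intros Hx.
  destruct (MVT_gen (fun x => sin x - x) 0 x (fun x => cos x - 1)) as [c [Hc E]].
  - intros; auto_derive; [easy|ring].
  - intros. apply continuity_pt_minus; [apply continuity_sin|apply continuity_pt_id].
  - rewrite sin_0, !Rminus_0_r in E. rewrite E, Rabs_mult.
    pose proof (cos_remainder c) as H1.
    assert (H2 : Rabs c <= Rabs x).
    { revert Hc. unfold Rmin, Rmax, Rabs. destruct (Rle_dec 0 x), (Rcase_abs c), (Rcase_abs x); lra. }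
    rewrite <- (pow2_abs x). rewrite <- (pow2_abs c) in H1.
    pose proof (Rabs_pos x). pose proof (Rabs_pos c). nra.
Qed.

(** From [e^(x+iy) - 1 - (x + iy) = e^x (e^(iy) - 1 - iy) + (e^x - 1 - x) + (e^x - 1) iy],
    each term being of second order. *)
Lemma Cexp_remainder (h : C) : Cmod h < 1 / 2 ->
  Cmod (Cexp h - 1 - h)%C <= 10 * Cmod h ^ 2.
Proof.
  intros Hh. pose proof (re_le_Cmod h) as Hx. pose proof (im_le_Cmod h) as Hy.
  pose proof (Cmod_ge_0 h) as Hp.
  set (m := Cmod h) in *. clearbody m. destruct h as [x y]; simpl in Hx, Hy.
  pose proof (exp_remainder x ltac:(lra)) as H1.
  pose proof (cos_remainder y) as H2. pose proof (sin_remainder y ltac:(lra)) as H3.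
  assert (Hx2 : x ^ 2 <= m ^ 2) by (rewrite <- pow2_abs; pose proof (Rabs_pos x); nra).
  assert (Hy2 : y ^ 2 <= m ^ 2) by (rewrite <- pow2_abs; pose proof (Rabs_pos y); nra).
  assert (Hxy : Rabs x * Rabs y <= m ^ 2) by (pose proof (Rabs_pos x); pose proof (Rabs_pos y); nra).
  assert (He : Rabs (exp x - 1) <= 2 * Rabs x).
  { replace (exp x - 1) with ((exp x - 1 - x) + x) by ring.
    eapply Rle_trans; [apply Rabs_triang|]. rewrite <- pow2_abs in H1.
    pose proof (Rabs_pos x); nra. }
  assert (He3 : Rabs (exp x) <= 3).
  { replace (exp x) with ((exp x - 1) + 1) by ring.
    eapply Rle_trans; [apply Rabs_triang|]. rewrite Rabs_R1. lra. }
  eapply Rle_trans; [apply Cmod_le_parts|]. unfold Cexp; simpl Re; simpl Im.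
  replace (exp x * cos y + -(1) + - x) with (exp x * (cos y - 1) + (exp x - 1 - x)) by ring.
  replace (exp x * sin y + -0 + - y) with (exp x * (sin y - y) + (exp x - 1) * y) by ring.
  pose proof (Rabs_triang (exp x * (cos y - 1)) (exp x - 1 - x)) as T1.
  pose proof (Rabs_triang (exp x * (sin y - y)) ((exp x - 1) * y)) as T2.
  rewrite (Rabs_mult (exp x)) in T1.
  rewrite (Rabs_mult (exp x)), (Rabs_mult (exp x - 1)) in T2.
  pose proof (Rabs_pos (cos y - 1)). pose proof (Rabs_pos (sin y - y)).
  pose proof (Rabs_pos (exp x)). pose proof (Rabs_pos y). pose proof (Rabs_pos x).
  assert (Rabs (exp x) * Rabs (cos y - 1) <= 3 * m^2) by (apply Rmult_le_compat; lra).
  assert (Rabs (exp x) * Rabs (sin y - y) <= 3 * m^2) by (apply Rmult_le_compat; lra).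
  assert (Rabs (exp x - 1) * Rabs y <= 2 * (Rabs x * Rabs y)) by nra.
  lra.
Qed.

Lemma cder_Cexp (z : C) : cder Cexp z (Cexp z).
Proof.
  apply cder_of_quadratic_remainder with (K := Cmod (Cexp z) * 10) (delta := 1 / 2); [lra|].
  intros w Hw. replace w with (z + (w - z))%C at 1 by ring. rewrite Cexp_plus.
  replace (Cexp z * Cexp (w - z) - Cexp z - Cexp z * (w - z))%C
    with (Cexp z * (Cexp (w - z) - 1 - (w - z)))%C by ring.
  rewrite Cmod_mult, Rmult_assoc. apply Rmult_le_compat_l; [apply Cmod_ge_0|].
  apply Cexp_remainder, Hw.
Qed.

Lemma Re_Cexp_pos (w : C) : in_disc w -> 0 < Re (Cexp w).
Proof.
  intros Hw. unfold in_disc in Hw. pose proof (im_le_Cmod w) as H.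
  assert (Hi : Rabs (Im w) < 1) by lra. apply Rabs_lt_between in Hi.
  unfold Cexp; simpl. apply Rmult_lt_0_compat; [apply exp_pos|].
  pose proof PI2_1. apply cos_gt_0; lra.
Qed.

(** * Complex power series on the unit disc *)

Definition Cseries (u : nat -> C) (s : C) : Prop :=
  @is_series C_AbsRing C_NormedModule u s.

Lemma Cseries_unique (u : nat -> C) (s t : C) : Cseries u s -> Cseries u t -> s = t.
Proof.
  intros Hs Ht. exact (filterlim_locally_unique (F := eventually) _ s t Hs Ht).
Qed.

Lemma Cseries_ext (u v : nat -> C) (s : C) :
  (forall n, u n = v n) -> Cseries u s -> Cseries v s.
Proof. intros E. exact (is_series_ext u v s E). Qed.

Lemma Cseries_plus (u v : nat -> C) (s t : C) :
  Cseries u s -> Cseries v t -> Cseries (fun n => u n + v n)%C (s + t)%C.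
Proof. exact (is_series_plus u v s t). Qed.

Lemma Cseries_scal (c : C) (u : nat -> C) (s : C) :
  Cseries u s -> Cseries (fun n => c * u n)%C (c * s)%C.
Proof. exact (is_series_scal c u s). Qed.

Lemma Cseries_shift (u : nat -> C) (s : C) :
  Cseries (fun n => u (S n)) s -> Cseries u (s + u 0%nat)%C.
Proof.
  intros H. apply is_series_decr_1.
  match goal with |- is_series _ ?t => replace t with s end; [exact H|].
  change (s = (s + u 0%nat) + - u 0%nat)%C; ring.
Qed.

Lemma Cmod_Cseries_le (u : nat -> C) (b : nat -> R) (s : C) (l : R) :
  Cseries u s -> is_series b l -> (forall n, Cmod (u n) <= b n) -> Cmod s <= l.
Proof.
  intros Hu Hb Hle.
  assert (H1 : is_lim_seq (fun n => Cmod (sum_n u n)) (Cmod s)).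
  { apply (filterlim_comp _ _ _ (sum_n u) Cmod eventually (locally s)); [exact Hu|].
    exact (filterlim_norm (K := C_AbsRing) (V := C_NormedModule) s). }
  assert (H2 : is_lim_seq (sum_n b) l) by exact Hb.
  apply (is_lim_seq_le (fun n => Cmod (sum_n u n)) (sum_n b) (Cmod s) l); [|exact H1|exact H2].
  intros n. induction n as [|n IH].
  - rewrite !sum_O. apply Hle.
  - rewrite !sum_Sn. eapply Rle_trans; [apply Cmod_triangle|].
    apply Rplus_le_compat; [exact IH|apply Hle].
Qed.

(** Absolute convergence in the open unit disc.  Only moduli occur, so that the
    theory of the real radius of convergence applies, in particular its invariance
    under termwise differentiation. *)
Definition disc_coefficients (a : nat -> C) : Prop :=
  forall r, 0 <= r < 1 -> ex_series (fun n => Cmod (a n) * r ^ n).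

Definition Cderive_coefficients (a : nat -> C) : nat -> C :=
  fun n => (RtoC (INR (S n)) * a (S n))%C.

Lemma disc_coefficients_CV_radius (a : nat -> C) :
  Rbar_le 1 (CV_radius (fun n => Cmod (a n))) -> disc_coefficients a.
Proof.
  intros H r Hr.
  assert (Hl : Rbar_lt (Rabs r) (CV_radius (fun n => Cmod (a n)))).
  { eapply Rbar_lt_le_trans; [|exact H]. simpl. rewrite Rabs_pos_eq; lra. }
  apply CV_disk_inside in Hl. eapply ex_series_ext; [|exact Hl].
  intros n. apply Rabs_pos_eq. apply Rmult_le_pos; [apply Cmod_ge_0|apply pow_le; lra].
Qed.

(** The radius of convergence is the supremum of the [r] for which the terms
    [a_n r^n] stay bounded. *)
Lemma CV_radius_ge_1 (a : nat -> R) :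
  (forall r, 0 <= r < 1 -> exists M, forall n, Rabs (a n * r ^ n) <= M) ->
  Rbar_le 1 (CV_radius a).
Proof.
  intros H. destruct (CV_radius_bounded a) as [Hub _].
  assert (Hr : forall r, 0 <= r < 1 -> Rbar_le r (CV_radius a)) by (intros r Hr; apply Hub, H, Hr).
  destruct (CV_radius a) as [c| |]; simpl in *.
  - apply Rnot_lt_le. intros Hc. pose proof (Hr 0 ltac:(lra)).
    pose proof (Hr ((1 + c) / 2) ltac:(lra)). lra.
  - exact I.
  - apply (Hr 0). lra.
Qed.

Lemma CV_radius_disc_coefficients (a : nat -> C) :
  disc_coefficients a -> Rbar_le 1 (CV_radius (fun n => Cmod (a n))).
Proof.
  intros H. apply CV_radius_ge_1. intros r Hr.
  pose proof (ex_series_lim_0 _ (H r Hr)) as Hl.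
  destruct (filterlim_bounded (fun n => Cmod (a n) * r ^ n)) as [M HM].
  { exists 0. exact Hl. }
  exists M. exact HM.
Qed.

Lemma disc_coefficients_derive (a : nat -> C) :
  disc_coefficients a -> disc_coefficients (Cderive_coefficients a).
Proof.
  intros H. apply disc_coefficients_CV_radius.
  rewrite (CV_radius_ext _ (PS_derive (fun n => Cmod (a n)))).
  - rewrite CV_radius_derive. apply CV_radius_disc_coefficients, H.
  - intros n. unfold PS_derive, Cderive_coefficients.
    rewrite Cmod_mult, Cmod_R, Rabs_pos_eq; [reflexivity|apply pos_INR].
Qed.

(** Convergence at the real point [r] bounds the partial sums, hence the terms
    [a_n r^n], and boundedness for all [r < 1] puts the radius at 1 or more. *)
Lemma disc_coefficients_of_series (a : nat -> C) (A : C -> C) :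
  (forall z, in_disc z -> Cseries (fun n => a n * z ^ n)%C (A z)) ->
  disc_coefficients a.
Proof.
  intros H. apply disc_coefficients_CV_radius, CV_radius_ge_1. intros r Hr.
  assert (Hz : in_disc (RtoC r)) by (unfold in_disc; rewrite Cmod_R, Rabs_pos_eq; lra).
  destruct (filterlim_bounded (K := C_AbsRing) (V := C_NormedModule)
    (sum_n (fun n => a n * RtoC r ^ n)%C)) as [M HM].
  { eexists. exact (H _ Hz). }
  assert (HM' : forall n, Cmod (sum_n (fun n => a n * RtoC r ^ n)%C n) <= M) by exact HM.
  exists (M + M). intros n.
  rewrite Rabs_mult, (Rabs_pos_eq (Cmod _)), <- RPow_abs by apply Cmod_ge_0.
  rewrite <- Cmod_R, <- Cmod_pow, <- Cmod_mult.
  destruct n as [|n].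
  - specialize (HM' 0%nat). rewrite sum_O in HM'.
    pose proof (Cmod_ge_0 (a 0%nat * RtoC r ^ 0)%C). lra.
  - pose proof (HM' n) as H1. specialize (HM' (S n)). rewrite sum_Sn in HM'.
    set (s := sum_n _ n) in *.
    replace (a (S n) * RtoC r ^ S n)%C with ((s + a (S n) * RtoC r ^ S n) + - s)%C by ring.
    eapply Rle_trans; [apply Cmod_triangle|]. rewrite Cmod_opp.
    apply Rplus_le_compat; [exact HM'|exact H1].
Qed.

Lemma disc_coefficients_bounded (a : nat -> C) :
  (forall n, Cmod (a n) <= 1) -> disc_coefficients a.
Proof.
  intros H r Hr.
  apply (ex_series_le (K := R_AbsRing) (V := R_CompleteNormedModule) _ (fun n => r ^ n)).
  - intros n. change (Rabs (Cmod (a n) * r ^ n) <= r ^ n).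
    assert (0 <= r ^ n) by (apply pow_le; lra). pose proof (Cmod_ge_0 (a n)).
    specialize (H n). rewrite Rabs_pos_eq; nra.
  - apply ex_series_geom. rewrite Rabs_pos_eq; lra.
Qed.

Definition Cpower_series (a : nat -> C) (z : C) : C :=
  iota (T := C_CompleteNormedModule) (Cseries (fun n => a n * z ^ n)%C).

Lemma Cpower_series_correct (a : nat -> C) (z : C) :
  disc_coefficients a -> in_disc z ->
  Cseries (fun n => a n * z ^ n)%C (Cpower_series a z).
Proof.
  intros Ha Hz.
  destruct (ex_series_le (K := C_AbsRing) (V := C_CompleteNormedModule)
    (fun n => a n * z ^ n)%C (fun n => Cmod (a n) * Cmod z ^ n)) as [s Hs].
  - intros n. change (Cmod (a n * z ^ n)%C <= Cmod (a n) * Cmod z ^ n).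
    rewrite Cmod_mult, Cmod_pow. apply Rle_refl.
  - apply Ha. split; [apply Cmod_ge_0|exact Hz].
  - apply (iota_correct (V := C_CompleteNormedModule) (Cseries (fun n => a n * z ^ n)%C)).
    exists s. split; [exact Hs|]. intros t Ht. exact (Cseries_unique _ _ _ Hs Ht).
Qed.

(** Induction on [n]: with [D_n = w^n - z^n - n z^(n-1) (w - z)] one has
    [D_(n+1) = w D_n + n z^(n-1) (w - z)^2]. *)
Lemma Cpow_taylor_remainder (z w : C) (rho : R) (n : nat) :
  Cmod z <= rho -> Cmod w <= rho ->
  Cmod (w ^ S (S n) - z ^ S (S n) - RtoC (INR (S (S n))) * z ^ S n * (w - z))%C
    <= INR (S n) * INR (S (S n)) * rho ^ n * Cmod (w - z)%C ^ 2.
Proof.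
  intros Hz Hw. pose proof (Cmod_ge_0 z) as Hz0.
  assert (Hpow : forall k, Cmod z ^ k <= rho ^ k) by (intros; apply pow_incr; lra).
  pose proof (pow2_ge_0 (Cmod (w - z)%C)) as Hq.
  induction n as [|n IH].
  - replace (w ^ 2 - z ^ 2 - RtoC (INR 2) * z ^ 1 * (w - z))%C with ((w - z) * (w - z))%C
      by (simpl; rewrite RtoC_plus; ring).
    rewrite Cmod_mult. simpl in *. nra.
  - replace (w ^ S (S (S n)) - z ^ S (S (S n)) - RtoC (INR (S (S (S n)))) * z ^ S (S n) * (w - z))%C
      with (w * (w ^ S (S n) - z ^ S (S n) - RtoC (INR (S (S n))) * z ^ S n * (w - z))
            + RtoC (INR (S (S n))) * z ^ S n * ((w - z) * (w - z)))%C
      by (rewrite !S_INR, !RtoC_plus; simpl; ring).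
    eapply Rle_trans; [apply Cmod_triangle|].
    rewrite !Cmod_mult, Cmod_pow, Cmod_R, (Rabs_pos_eq (INR _)) by apply pos_INR.
    set (q := Cmod (w - z)%C) in *.
    apply Rle_trans with (rho * (INR (S n) * INR (S (S n)) * rho ^ n * q ^ 2)
       + INR (S (S n)) * rho ^ S n * (q * q)).
    + apply Rplus_le_compat.
      * apply Rmult_le_compat; try apply Cmod_ge_0; assumption.
      * apply Rmult_le_compat_r; [nra|]. apply Rmult_le_compat_l; [apply pos_INR|apply Hpow].
    + assert (Hr : 0 <= rho ^ S n * q ^ 2) by (apply Rmult_le_pos; [apply pow_le; lra|exact Hq]).
      pose proof (pos_INR (S (S n))) as Hn.
      rewrite (S_INR (S (S n))).
      replace (rho * (INR (S n) * INR (S (S n)) * rho ^ n * q ^ 2) + INR (S (S n)) * rho ^ S n * (q * q))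
        with ((INR (S n) + 1) * INR (S (S n)) * (rho ^ S n * q ^ 2)) by (simpl; ring).
      rewrite <- S_INR. nra.
Qed.

Lemma Cseries_drop (u : nat -> C) (s : C) :
  u 0%nat = 0 -> Cseries u s -> Cseries (fun n => u (S n)) s.
Proof.
  intros H0 H.
  apply (is_series_incr_1 (K := C_AbsRing) (V := C_NormedModule) u).
  rewrite H0. match goal with |- is_series _ ?t => replace t with s end; [exact H|].
  change (s = s + 0)%C; ring.
Qed.

(** Summing [Cpow_taylor_remainder] over the series bounds the Taylor remainder of
    [A] by [B |w - z|^2], where [B] is the sum at some [rho < 1] of the moduli of the
    terms of the twice differentiated series. *)
Lemma cder_power_series (a : nat -> C) (A : C -> C) (z l : C) :
  disc_coefficients a ->
  (forall w, in_disc w -> Cseries (fun n => a n * w ^ n)%C (A w)) ->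
  in_disc z -> Cseries (fun n => Cderive_coefficients a n * z ^ n)%C l ->
  cder A z l.
Proof.
  intros Ha HA Hz Hl. unfold in_disc in Hz. pose proof (Cmod_ge_0 z) as Hz0.
  (* Any radius strictly between |z| and 1 serves as a common bound for z and w. *)
  set (rho := (1 + Cmod z) / 2).
  assert (Hrho : Cmod z < rho < 1) by (unfold rho; lra).
  destruct (disc_coefficients_derive _ (disc_coefficients_derive _ Ha) rho ltac:(lra)) as [B HB].
  apply cder_of_quadratic_remainder with (K := B) (delta := rho - Cmod z); [lra|].
  intros w Hw.
  assert (Hwr : Cmod w <= rho).
  { replace w with ((w - z) + z)%C by ring. eapply Rle_trans; [apply Cmod_triangle|lra]. }
  set (d := fun n => match n with O => RtoC 0 | S k => (Cderive_coefficients a k * z ^ k)%C end).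
  assert (Hd : Cseries d l).
  { replace l with (l + d 0%nat)%C by (simpl; ring). apply Cseries_shift. exact Hl. }
  assert (Hu : Cseries (fun n => a n * w ^ n + (-(1)) * (a n * z ^ n) + (- (w - z)) * d n)%C
                 (A w - A z - l * (w - z))%C).
  { replace (A w - A z - l * (w - z))%C with (A w + (-(1)) * A z + (- (w - z)) * l)%C by ring.
    apply Cseries_plus; [apply Cseries_plus|]; [apply HA; unfold in_disc; lra| |];
      apply Cseries_scal; [apply HA; exact Hz|exact Hd]. }
  apply Cseries_drop in Hu; [|simpl; ring].
  apply Cseries_drop in Hu; [|unfold d, Cderive_coefficients; simpl; ring].
  apply (Cmod_Cseries_le _ _ _ _ Hu (is_series_scal_r (Cmod (w - z)%C ^ 2) _ _ HB)).
  intros n. unfold d, Cderive_coefficients.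
  rewrite !Cmod_mult, !Cmod_R, !(Rabs_pos_eq (INR _)) by apply pos_INR.
  replace (_ + _ + _)%C with (a (S (S n)) *
    (w ^ S (S n) - z ^ S (S n) - RtoC (INR (S (S n))) * z ^ S n * (w - z)))%C by ring.
  rewrite Cmod_mult.
  pose proof (Cpow_taylor_remainder z w rho n ltac:(lra) Hwr) as HT.
  apply (Rmult_le_compat_l _ _ _ (Cmod_ge_0 (a (S (S n))))) in HT.
  eapply Rle_trans; [exact HT|]. right. ring.
Qed.

(** * Mean value theorems along segments *)

Lemma is_derive_Re_line (g : C -> C) (z d l : C) (t : R) :
  cder g (z + RtoC t * d)%C l ->
  is_derive (fun s : R => Re (g (z + RtoC s * d)%C)) t (Re (l * d)%C).
Proof.
  intros Hg. split; [apply is_linear_scal_l|].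
  intros x Hx eps.
  assert (E : t = x) by exact (is_filter_lim_locally_unique (K := R_AbsRing) (V := R_NormedModule) t x Hx).
  subst x.
  set (e := eps / (Cmod d + 1)). pose proof (Cmod_ge_0 d) as Hd0.
  assert (He : 0 < e) by (apply Rdiv_lt_0_compat; [apply cond_pos|lra]).
  destruct (cder_remainder _ _ _ e Hg He) as [delta [Hdel H]].
  assert (Hr : 0 < delta / (Cmod d + 1)) by (apply Rdiv_lt_0_compat; lra).
  exists (mkposreal _ Hr). intros s Hs. change (Rabs (s - t) < delta / (Cmod d + 1)) in Hs.
  change (Rabs (Re (g (z + RtoC s * d)%C) - Re (g (z + RtoC t * d)%C) - (s - t) * Re (l * d)%C)
    <= eps * Rabs (s - t)).
  assert (E : (z + RtoC s * d - (z + RtoC t * d) = RtoC (s - t) * d)%C) by (rewrite RtoC_minus; ring).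
  assert (Hlt : Rabs (s - t) * (Cmod d + 1) < delta).
  { apply Rlt_le_trans with (delta / (Cmod d + 1) * (Cmod d + 1));
      [apply Rmult_lt_compat_r; lra|right; field; lra]. }
  pose proof (Rabs_pos (s - t)) as Hst.
  specialize (H (z + RtoC s * d)%C). rewrite E, Cmod_mult, Cmod_R in H.
  specialize (H ltac:(nra)).
  replace (Re (g (z + RtoC s * d)%C) - Re (g (z + RtoC t * d)%C) - (s - t) * Re (l * d)%C)
    with (Re (g (z + RtoC s * d) - g (z + RtoC t * d) - l * (RtoC (s - t) * d))%C)
    by (unfold Re; simpl; ring).
  eapply Rle_trans; [apply re_le_Cmod|]. eapply Rle_trans; [exact H|].
  assert (Hee : e * (Cmod d + 1) = eps) by (unfold e; field; lra).
  rewrite <- Hee. nra.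
Qed.

(** The mean value theorem fails for complex values, but holds for each real
    functional [Re (k * _)]; choosing [k] afterwards gives both the mean value
    inequality and the injectivity criterion. *)
Lemma Re_mean_value (g g' : C -> C) (z w k : C) :
  (forall t, 0 <= t <= 1 -> cder g (z + RtoC t * (w - z))%C (g' (z + RtoC t * (w - z))%C)) ->
  exists t, 0 <= t <= 1 /\
    Re (k * (g w - g z))%C = Re (k * (g' (z + RtoC t * (w - z)) * (w - z)))%C.
Proof.
  intros H.
  assert (HD : forall t, 0 <= t <= 1 ->
    is_derive (fun s : R => Re (k * g (z + RtoC s * (w - z)))%C) t
      (Re (k * g' (z + RtoC t * (w - z)) * (w - z))%C)).
  { intros t Ht. apply (is_derive_Re_line (fun u => k * g u)%C). apply cder_scal, H, Ht. }
  destruct (MVT_gen (fun s : R => Re (k * g (z + RtoC s * (w - z)))%C) 0 1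
    (fun t => Re (k * g' (z + RtoC t * (w - z)) * (w - z))%C)) as [t [Ht E]].
  - intros t Ht. apply HD. rewrite Rmin_left, Rmax_right in Ht; lra.
  - intros t Ht. apply derivable_continuous_pt, ex_derive_Reals_0. eexists. apply HD.
    rewrite Rmin_left, Rmax_right in Ht; lra.
  - rewrite Rmin_left, Rmax_right in Ht by lra. exists t. split; [exact Ht|].
    replace (z + RtoC 1 * (w - z))%C with w in E by ring.
    replace (z + RtoC 0 * (w - z))%C with z in E by ring.
    rewrite Rminus_0_r, Rmult_1_r in E.
    replace (k * (g' (z + RtoC t * (w - z)) * (w - z)))%C
      with (k * g' (z + RtoC t * (w - z)) * (w - z))%C by ring.
    rewrite <- E. simpl. ring.
Qed.

Lemma Re_Cconj_mult (z : C) : Re (Cconj z * z)%C = Cmod z ^ 2.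
Proof. rewrite Cmod2_alt. unfold Re, Im; simpl. ring. Qed.

(** Take [k] to be the conjugate of [g w - g z] in [Re_mean_value]. *)
Lemma mean_value_inequality (g g' : C -> C) (z w : C) (M : R) :
  (forall t, 0 <= t <= 1 ->
     cder g (z + RtoC t * (w - z))%C (g' (z + RtoC t * (w - z))%C) /\
     Cmod (g' (z + RtoC t * (w - z))%C) <= M) ->
  Cmod (g w - g z)%C <= M * Cmod (w - z)%C.
Proof.
  intros H.
  destruct (Re_mean_value g g' z w (Cconj (g w - g z))) as [t [Ht E]].
  { intros t Ht. apply H, Ht. }
  destruct (H t Ht) as [_ HM]. rewrite Re_Cconj_mult in E.
  set (D := (g w - g z)%C) in *.
  pose proof (re_le_Cmod (Cconj D * (g' (z + RtoC t * (w - z)) * (w - z)))%C) as Hb.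
  rewrite <- E, !Cmod_mult, Cmod_conj in Hb.
  pose proof (Cmod_ge_0 D) as HD. pose proof (Cmod_ge_0 (w - z)%C) as Hq.
  rewrite Rabs_pos_eq in Hb by apply pow2_ge_0.
  destruct (Rle_lt_or_eq_dec _ _ HD) as [Hp|Hp].
  - apply Rmult_le_reg_l with (Cmod D); [exact Hp|].
    apply (Rmult_le_compat_r _ _ _ Hq) in HM. nra.
  - rewrite <- Hp. apply Rmult_le_pos; [|exact Hq].
    eapply Rle_trans; [apply Cmod_ge_0|exact HM].
Qed.

Lemma in_disc_segment (z w : C) (t : R) :
  in_disc z -> in_disc w -> 0 <= t <= 1 -> in_disc (z + RtoC t * (w - z))%C.
Proof.
  unfold in_disc. intros Hz Hw Ht.
  replace (z + RtoC t * (w - z))%C with (RtoC (1 - t) * z + RtoC t * w)%C by (rewrite RtoC_minus; ring).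
  eapply Rle_lt_trans; [apply Cmod_triangle|].
  rewrite !Cmod_mult, !Cmod_R, !Rabs_pos_eq by lra.
  pose proof (Rmax_l (Cmod z) (Cmod w)). pose proof (Rmax_r (Cmod z) (Cmod w)).
  apply Rle_lt_trans with (Rmax (Cmod z) (Cmod w)); [nra|].
  apply Rmax_lub_lt; assumption.
Qed.

(** * Means over vertical periods *)

Lemma is_derive_Re_horizontal (g : C -> C) (x y : R) (l : C) :
  cder g (x, y) l -> is_derive (fun u : R => Re (g (u, y))) x (Re l).
Proof.
  intros H.
  assert (E : forall u : R, ((0, y) + RtoC u * RtoC 1)%C = (u, y)).
  { intros u. unfold Cplus, Cmult, RtoC; simpl. f_equal; ring. }
  apply (is_derive_ext (fun u : R => Re (g ((0, y) + RtoC u * RtoC 1)%C))).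
  - intros u. rewrite E. reflexivity.
  - replace l with (l * RtoC 1)%C by ring. apply is_derive_Re_line. rewrite E. exact H.
Qed.

Lemma is_derive_Re_vertical (g : C -> C) (x y : R) (l : C) :
  cder g (x, y) l -> is_derive (fun v : R => Re (g (x, v))) y (Re (l * Ci)%C).
Proof.
  intros H.
  assert (E : forall u : R, ((x, 0) + RtoC u * Ci)%C = (x, u)).
  { intros u. unfold Cplus, Cmult, RtoC, Ci; simpl. f_equal; ring. }
  apply (is_derive_ext (fun u : R => Re (g ((x, 0) + RtoC u * Ci)%C))).
  - intros u. rewrite E. reflexivity.
  - apply is_derive_Re_line. rewrite E. exact H.
Qed.

Lemma is_derive_Im_vertical (g : C -> C) (x y : R) (l : C) :
  cder g (x, y) l -> is_derive (fun v : R => Im (g (x, v))) y (Re l).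
Proof.
  intros H.
  apply (is_derive_ext (fun v : R => Re (- Ci * g (x, v))%C)).
  - intros v. unfold Re, Im; simpl. ring.
  - replace (Re l) with (Re (- Ci * l * Ci)%C) by (unfold Re; simpl; ring).
    apply (is_derive_Re_vertical (fun w => - Ci * g w)%C), cder_scal, H.
Qed.

Lemma continuous_Re_vertical (g : C -> C) (x y : R) (l : C) :
  cder g (x, y) l -> continuous (fun v : R => Re (g (x, v))) y.
Proof.
  intros H. apply (ex_derive_continuous (fun v : R => Re (g (x, v)))).
  eexists. apply (is_derive_Re_vertical _ _ _ _ H).
Qed.

(** Along a vertical line [Re W'] is the derivative of [Im W], so its integral
    over a period vanishes. *)
Lemma RInt_Re_vertical_derivative (W W' : C -> C) (x : R) :
  (forall y, cder W (x, y) (W' (x, y))) ->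
  (forall y, exists l, cder W' (x, y) l) ->
  W (x, 2 * PI) = W (x, 0) ->
  RInt (fun y => Re (W' (x, y))) 0 (2 * PI) = 0.
Proof.
  intros HW HW' Hper.
  assert (H : is_RInt (fun y => Re (W' (x, y))) 0 (2 * PI)
     (minus (Im (W (x, 2 * PI))) (Im (W (x, 0))))).
  { apply (is_RInt_derive (fun y => Im (W (x, y)))).
    - intros y _. apply is_derive_Im_vertical, HW.
    - intros y _. destruct (HW' y) as [l Hl]. exact (continuous_Re_vertical _ _ _ _ Hl). }
  rewrite (is_RInt_unique _ _ _ _ H), Hper. unfold minus, plus, opp; simpl. ring.
Qed.

(** Differentiation under the integral sign; it needs [W'] to be continuous, which
    follows from its differentiability. *)
Lemma is_derive_RInt_Re_vertical (W W' : C -> C) (x : R) :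
  x < 0 ->
  (forall z, Re z < 0 -> cder W z (W' z)) ->
  (forall z, Re z < 0 -> exists l, cder W' z l) ->
  is_derive (fun u => RInt (fun y => Re (W (u, y))) 0 (2 * PI)) x
    (RInt (fun y => Re (W' (x, y))) 0 (2 * PI)).
Proof.
  intros Hx HW HW'.
  assert (Hloc : locally x (fun u => u < 0)).
  { assert (Hx' : 0 < - x) by lra. exists (mkposreal _ Hx'). intros u Hu.
    change (Rabs (u - x) < - x) in Hu. apply Rabs_lt_between in Hu. lra. }
  assert (HD : forall u y, u < 0 -> Derive (fun s => Re (W (s, y))) u = Re (W' (u, y))).
  { intros u y Hu. apply is_derive_unique, is_derive_Re_horizontal, HW, Hu. }
  rewrite (RInt_ext (fun y => Re (W' (x, y))) (fun y => Derive (fun s => Re (W (s, y))) x))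
    by (intros; symmetry; apply HD, Hx).
  apply (is_derive_RInt_param (fun u y => Re (W (u, y)))).
  - apply filter_imp with (2 := Hloc). intros u Hu y _. eexists.
    apply is_derive_Re_horizontal, HW, Hu.
  - intros y _ eps. destruct (HW' (x, y) Hx) as [l Hl].
    destruct (cder_continuous _ _ _ eps Hl (cond_pos eps)) as [d [Hd H]].
    assert (Hm : 0 < Rmin (d / 2) (- x)) by (apply Rmin_pos; lra).
    exists (mkposreal _ Hm). simpl. intros u v Hu Hv.
    pose proof (Rmin_l (d / 2) (- x)). pose proof (Rmin_r (d / 2) (- x)).
    assert (Hu0 : u < 0) by (apply Rabs_lt_between in Hu; lra).
    rewrite !HD by assumption.
    replace (Re (W' (u, v)) - Re (W' (x, y))) with (Re (W' (u, v) - W' (x, y))%C)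
      by (unfold Re; simpl; ring).
    eapply Rle_lt_trans; [apply re_le_Cmod|]. apply H.
    eapply Rle_lt_trans; [apply Cmod_le_parts|]. unfold Re, Im; simpl.
    change (u + - x) with (u - x). change (v + - y) with (v - y). lra.
  - apply filter_imp with (2 := Hloc). intros u Hu.
    apply (ex_RInt_continuous (V := R_CompleteNormedModule)). intros y _.
    exact (continuous_Re_vertical _ _ _ _ (HW (u, y) Hu)).
Qed.

(** A form of Cauchy's theorem: the mean over a vertical period does not depend on the
    line, hence equals the limit of [W] at [Re z = - infinity]. *)
Lemma RInt_Re_vertical_period (W W' : C -> C) (L : C) (x : R) :
  (forall z, Re z < 0 -> cder W z (W' z)) ->
  (forall z, Re z < 0 -> exists l, cder W' z l) ->
  (forall u, u < 0 -> W (u, 2 * PI) = W (u, 0)) ->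
  (forall eps, 0 < eps -> exists X, X < 0 /\
     forall z, Re z < X -> Cmod (W z - L)%C <= eps) ->
  x < 0 ->
  RInt (fun y => Re (W (x, y))) 0 (2 * PI) = 2 * PI * Re L.
Proof.
  intros HW HW' Hper Hlim Hx.
  set (I := fun u => RInt (fun y => Re (W (u, y))) 0 (2 * PI)).
  pose proof PI_RGT_0 as HPI.
  assert (HI : forall u, u < 0 -> is_derive I u 0).
  { intros u Hu. rewrite <- (RInt_Re_vertical_derivative W W' u).
    - apply is_derive_RInt_Re_vertical; assumption.
    - intros y. apply HW, Hu.
    - intros y. apply HW', Hu.
    - apply Hper, Hu. }
  assert (Hconst : forall u, u < x -> I x = I u).
  { intros u Hu.
    destruct (MVT_gen I u x (fun _ => 0)) as [c [_ Hc]].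
    - intros c Hc. apply HI. rewrite Rmin_left, Rmax_right in Hc; lra.
    - intros c Hc. apply derivable_continuous_pt, ex_derive_Reals_0. eexists. apply HI.
      rewrite Rmin_left, Rmax_right in Hc; lra.
    - lra. }
  change (I x = 2 * PI * Re L).
  apply Rminus_diag_uniq, Rabs_eq_0. apply Rle_antisym; [|apply Rabs_pos].
  apply le_epsilon. intros e He. rewrite Rplus_0_l.
  destruct (Hlim (e / (2 * PI))) as [X [HX H]].
  { apply Rdiv_lt_0_compat; lra. }
  set (u := Rmin x X - 1). pose proof (Rmin_l x X). pose proof (Rmin_r x X).
  assert (Hu : u < x /\ u < X /\ u < 0) by (unfold u; lra). destruct Hu as [Hu1 [Hu2 Hu3]].
  rewrite (Hconst u Hu1).
  assert (Hex : ex_RInt (fun y => Re (W (u, y))) 0 (2 * PI)).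
  { apply (ex_RInt_continuous (V := R_CompleteNormedModule)). intros y _.
    exact (continuous_Re_vertical _ _ _ _ (HW (u, y) Hu3)). }
  assert (Hc : ex_RInt (fun _ : R => Re L) 0 (2 * PI)) by apply ex_RInt_const.
  replace (I u - 2 * PI * Re L) with (RInt (fun y => Re (W (u, y)) - Re L) 0 (2 * PI)).
  - apply Rle_trans with ((2 * PI - 0) * (e / (2 * PI))); [|right; field; lra].
    apply abs_RInt_le_const; [lra| |].
    + exact (ex_RInt_minus _ _ _ _ Hex Hc).
    + intros y _.
      replace (Re (W (u, y)) - Re L) with (Re (W (u, y) - L)%C) by (unfold Re; simpl; ring).
      eapply Rle_trans; [apply re_le_Cmod|]. apply H. exact Hu2.
  - transitivity (minus (RInt (fun y => Re (W (u, y))) 0 (2 * PI)) (RInt (fun _ : R => Re L) 0 (2 * PI))).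
    + exact (RInt_minus _ _ _ _ Hex Hc).
    + rewrite RInt_const. unfold I, minus, plus, opp, scal; simpl. unfold mult; simpl. ring.
Qed.

Lemma is_RInt_Re_vertical_period (W W' : C -> C) (L : C) (x : R) :
  (forall z, Re z < 0 -> cder W z (W' z)) ->
  (forall z, Re z < 0 -> exists l, cder W' z l) ->
  (forall u, u < 0 -> W (u, 2 * PI) = W (u, 0)) ->
  (forall eps, 0 < eps -> exists X, X < 0 /\
     forall z, Re z < X -> Cmod (W z - L)%C <= eps) ->
  x < 0 ->
  is_RInt (fun y => Re (W (x, y))) 0 (2 * PI) (2 * PI * Re L).
Proof.
  intros HW HW' Hper Hlim Hx.
  rewrite <- (RInt_Re_vertical_period W W' L x) by assumption.
  apply (RInt_correct (V := R_CompleteNormedModule)).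
  apply (ex_RInt_continuous (V := R_CompleteNormedModule)). intros y _.
  exact (continuous_Re_vertical _ _ _ _ (HW (x, y) Hx)).
Qed.

(** * Means of a Schwarz function over circles *)

Lemma cder_Cexp_opp (z : C) : cder (fun w => Cexp (- w)) z (- Cexp (- z))%C.
Proof.
  eapply cder_eq.
  - apply (cder_comp Cexp (fun w => - w)%C); [apply cder_Cexp|apply (cder_opp (fun w => w)), cder_id].
  - ring.
Qed.

Lemma Cexp_period (x : R) : Cexp (x, 2 * PI) = Cexp (x, 0).
Proof. unfold Cexp; simpl. rewrite cos_2PI, sin_2PI, cos_0, sin_0. reflexivity. Qed.

Lemma Cexp_opp_period (x : R) : Cexp (- (x, 2 * PI)%R) = Cexp (- (x, 0)%R).
Proof.
  unfold Cexp; simpl. rewrite !cos_neg, !sin_neg, cos_2PI, sin_2PI, cos_0, sin_0. reflexivity.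
Qed.

Lemma in_disc_Cexp (z : C) : Re z < 0 -> in_disc (Cexp z).
Proof.
  intros H. unfold in_disc. rewrite Cmod_Cexp, <- exp_0. apply exp_increasing, H.
Qed.

(** The derivative of [g z - c z - d z^2] is [o(z)], so the mean value inequality
    makes the function itself [o(z^2)]. *)
Lemma second_order_expansion (g g' : C -> C) (c d : C) (eps : R) :
  (forall z, in_disc z -> cder g z (g' z)) ->
  g 0 = 0 -> g' 0 = c -> cder g' 0 (RtoC 2 * d)%C -> 0 < eps ->
  exists delta, 0 < delta < 1 /\
    forall z, Cmod z < delta -> Cmod (g z - c * z - d * (z * z))%C <= eps * Cmod z ^ 2.
Proof.
  intros Hg H0 Hc Hd He.
  destruct (cder_remainder _ _ _ eps Hd He) as [delta [Hdel H]].
  exists (Rmin delta (1 / 2)).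
  pose proof (Rmin_l delta (1 / 2)). pose proof (Rmin_r delta (1 / 2)).
  split; [split; [apply Rmin_pos; lra|lra]|]. intros z Hz.
  pose proof (Cmod_ge_0 z) as Hz0.
  set (h := fun w => (g w + ((- c) * w + (- d) * (w * w)))%C).
  replace (g z - c * z - d * (z * z))%C with (h z - h 0)%C by (unfold h; rewrite H0; ring).
  replace (eps * Cmod z ^ 2) with (eps * Cmod z * Cmod (z - 0)%C)
    by (replace (z - 0)%C with z by ring; ring).
  apply (mean_value_inequality h (fun w => g' w + ((- c) * 1 + (- d) * (1 * w + w * 1)))%C).
  intros t Ht.
  assert (Et : (0 + RtoC t * (z - 0) = RtoC t * z)%C) by ring. rewrite Et.
  assert (Hm : Cmod (RtoC t * z)%C <= Cmod z)
    by (rewrite Cmod_mult, Cmod_R, Rabs_pos_eq by lra; nra).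
  split.
  - apply cder_plus; [apply Hg; unfold in_disc; lra|].
    apply cder_plus; [apply (cder_scal _ (fun w => w)), cder_id|].
    apply (cder_scal _ (fun w => w * w)%C), (cder_mult (fun w => w) (fun w => w)); apply cder_id.
  - specialize (H (RtoC t * z)%C). rewrite Hc in H.
    replace (RtoC t * z - 0)%C with (RtoC t * z)%C in H by ring.
    specialize (H ltac:(lra)).
    replace (_ + _)%C with (g' (RtoC t * z) - c - RtoC 2 * d * (RtoC t * z))%C
      by ring.
    eapply Rle_trans; [exact H|]. apply Rmult_le_compat_l; lra.
Qed.

Lemma is_RInt_Re_Cexp_opp (k : C) (x : R) :
  is_RInt (fun y => Re (k * Cexp (- (x, y)%R))%C) 0 (2 * PI) 0.
Proof.
  set (W := fun w => ((- k) * Cexp (- w))%C).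
  set (W' := fun w => (k * Cexp (- w))%C).
  assert (HW : forall w, cder W w (W' w)).
  { intros w. eapply cder_eq; [apply cder_scal, cder_Cexp_opp|]. unfold W'; ring. }
  assert (HW' : forall w, cder W' w (k * (- Cexp (- w)))%C).
  { intros w. apply cder_scal, cder_Cexp_opp. }
  replace 0 with (RInt (fun y => Re (W' (x, y))) 0 (2 * PI)) at 2.
  - apply (RInt_correct (V := R_CompleteNormedModule)).
    apply (ex_RInt_continuous (V := R_CompleteNormedModule)). intros y _.
    exact (continuous_Re_vertical _ _ _ _ (HW' (x, y))).
  - apply (RInt_Re_vertical_derivative W).
    + intros; apply HW.
    + intros; eexists; apply HW'.
    + unfold W. rewrite Cexp_opp_period. reflexivity.
Qed.

(** With [z = Cexp (x, y)], the mean of [omega(z) (A + B/z + K/z^2)] over the circle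
    [|z| = e^x] is the constant Laurent coefficient [B c + K d].  The period lemma
    applies after subtraction of [K c / z], which is unbounded as [z] tends to 0 but
    has mean zero. *)
Lemma circle_mean (omega omega' : C -> C) (c d A B K : C) (x : R) :
  (forall z, in_disc z -> cder omega z (omega' z)) ->
  (forall z, in_disc z -> exists l, cder omega' z l) ->
  omega 0 = 0 -> omega' 0 = c -> cder omega' 0 (RtoC 2 * d)%C ->
  x < 0 ->
  is_RInt (fun y => Re (omega (Cexp (x, y)) *
      (A + B * Cexp (- (x, y)%R) + K * (Cexp (- (x, y)%R) * Cexp (- (x, y)%R))))%C)
    0 (2 * PI) (2 * PI * Re (B * c + K * d)%C).
Proof.
  intros Homega Homega' H0 Hc Hd Hx.
  set (P := fun w => (A + B * Cexp (- w) + K * (Cexp (- w) * Cexp (- w)))%C).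
  set (P' := fun w => (- (B * Cexp (- w)) - RtoC 2 * K * (Cexp (- w) * Cexp (- w)))%C).
  set (W := fun w => (omega (Cexp w) * P w + (- (K * c)) * Cexp (- w))%C).
  set (W' := fun w => ((omega' (Cexp w) * Cexp w) * P w + omega (Cexp w) * P' w
     + (K * c) * Cexp (- w))%C).
  assert (Hsq : forall w, cder (fun w => Cexp (- w) * Cexp (- w))%C w
     (- (RtoC 2 * (Cexp (- w) * Cexp (- w))))%C).
  { intros w. eapply cder_eq; [apply cder_mult; apply cder_Cexp_opp|]. cbv beta; ring. }
  assert (HP : forall w, cder P w (P' w)).
  { intros w. unfold P. eapply cder_eq.
    - apply cder_plus; [apply cder_plus; [apply cder_const|apply cder_scal, cder_Cexp_opp]|].
      apply cder_scal, Hsq.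
    - unfold P'; ring. }
  assert (Ho : forall w, Re w < 0 ->
     cder (fun w => omega (Cexp w)) w (omega' (Cexp w) * Cexp w)%C).
  { intros w Hw. apply cder_comp; [apply Homega, in_disc_Cexp, Hw|apply cder_Cexp]. }
  assert (HW : forall w, Re w < 0 -> cder W w (W' w)).
  { intros w Hw. eapply cder_eq.
    - apply cder_plus; [apply cder_mult; [apply Ho, Hw|apply HP]|].
      apply cder_scal, cder_Cexp_opp.
    - unfold W'; ring. }
  assert (HW' : forall w, Re w < 0 -> exists l, cder W' w l).
  { intros w Hw. destruct (Homega' _ (in_disc_Cexp w Hw)) as [l Hl]. eexists.
    apply cder_plus; [apply cder_plus|].
    - apply cder_mult; [|apply HP]. apply cder_mult; [|apply cder_Cexp].
      apply (cder_comp omega'); [exact Hl|apply cder_Cexp].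
    - apply cder_mult; [apply Ho, Hw|]. unfold P'.
      apply (cder_ext (fun w => (- B) * Cexp (- w) + (- (RtoC 2 * K)) * (Cexp (- w) * Cexp (- w)))%C).
      + intros t. ring.
      + apply cder_plus; apply cder_scal; [apply cder_Cexp_opp|apply Hsq].
    - apply cder_scal, cder_Cexp_opp. }
  assert (HI : is_RInt (fun y => Re (W (x, y))) 0 (2 * PI) (2 * PI * Re (B * c + K * d)%C)).
  { apply (is_RInt_Re_vertical_period W W'); try assumption.
    - intros u _. unfold W, P. rewrite Cexp_opp_period, Cexp_period. reflexivity.
    - intros eps He.
      (* The remainder of omega enters the term with K undamped, so it must be small
         against K; every other term is a multiple of |z| and is governed by M. *)
      set (e1 := eps / (2 * (Cmod K + 1))).
      set (M := Cmod A * (e1 + Cmod c + Cmod d) + Cmod B * (e1 + Cmod d) + 1).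
      pose proof (Cmod_ge_0 A) as HA. pose proof (Cmod_ge_0 B) as HB. pose proof (Cmod_ge_0 K) as HK.
      pose proof (Cmod_ge_0 c) as Hc0. pose proof (Cmod_ge_0 d) as Hd0.
      assert (He1 : 0 < e1) by (apply Rdiv_lt_0_compat; lra).
      assert (HM : 0 < M).
      { unfold M. pose proof (Rmult_le_pos (Cmod A) (e1 + Cmod c + Cmod d)).
        pose proof (Rmult_le_pos (Cmod B) (e1 + Cmod d)). lra. }
      destruct (second_order_expansion omega omega' c d e1 Homega H0 Hc Hd He1)
        as [delta [Hdel Hexp]].
      assert (HeM : 0 < eps / (2 * M)) by (apply Rdiv_lt_0_compat; lra).
      set (rho := Rmin delta (eps / (2 * M))).
      pose proof (Rmin_l delta (eps / (2 * M))) as Hm1. pose proof (Rmin_r delta (eps / (2 * M))) as Hm2.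
      assert (Hrho : 0 < rho) by (apply Rmin_pos; lra). fold rho in Hm1, Hm2.
      exists (ln rho). split; [rewrite <- ln_1; apply ln_increasing; lra|].
      intros w Hw.
      assert (Hs : Cmod (Cexp w) < rho).
      { rewrite Cmod_Cexp, <- (exp_ln rho Hrho). apply exp_increasing, Hw. }
      set (z := Cexp w) in *. set (v := Cexp (- w)).
      assert (Hzv : (z * v = 1)%C) by apply Cexp_opp.
      set (R := (omega z - c * z - d * (z * z))%C).
      assert (HR : Cmod R <= e1 * Cmod z ^ 2) by (apply Hexp; lra).
      assert (Hzv' : Cmod z * Cmod v = 1) by (rewrite <- Cmod_mult, Hzv; apply Cmod_1).
      pose proof (Cmod_ge_0 z) as Hz0. pose proof (Cmod_ge_0 v) as Hv0.
      pose proof (Cmod_ge_0 R) as HR0.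
      replace (W w - (B * c + K * d))%C
        with (A * (R + c * z + d * (z * z)) + B * (R * v + d * z) + K * (R * v * v))%C.
      2:{ unfold W, P. fold z v.
          replace (omega z) with (R + c * z + d * (z * z))%C by (unfold R; ring).
          transitivity (A * (R + c * z + d * (z * z)) + B * (R * v + c * (z * v) + d * z * (z * v))
            + K * (R * v * v + c * v * (z * v) + d * (z * v) * (z * v)) - K * c * v
            - (B * c + K * d))%C; [rewrite !Hzv; ring|ring]. }
      set (s := Cmod z) in *.
      assert (HRv : Cmod R * Cmod v <= e1 * s) .
      { apply Rle_trans with (e1 * s ^ 2 * Cmod v); [apply Rmult_le_compat_r; lra|].
        replace (e1 * s ^ 2 * Cmod v) with (e1 * s * (s * Cmod v)) by ring. rewrite Hzv'. lra. }
      assert (HRvv : Cmod R * Cmod v * Cmod v <= e1).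
      { apply Rle_trans with (e1 * s * Cmod v); [apply Rmult_le_compat_r; lra|].
        rewrite Rmult_assoc, Hzv'. lra. }
      assert (Hss : s ^ 2 <= s) by nra.
      assert (T1 : Cmod (R + c * z + d * (z * z))%C <= (e1 + Cmod c + Cmod d) * s).
      { eapply Rle_trans; [apply Cmod_triangle|].
        eapply Rle_trans; [apply Rplus_le_compat_r, Cmod_triangle|].
        rewrite !Cmod_mult. fold s. nra. }
      assert (T2 : Cmod (R * v + d * z)%C <= (e1 + Cmod d) * s).
      { eapply Rle_trans; [apply Cmod_triangle|]. rewrite !Cmod_mult. fold s. lra. }
      eapply Rle_trans; [apply Cmod_triangle|].
      eapply Rle_trans; [apply Rplus_le_compat_r, Cmod_triangle|].
      rewrite (Cmod_mult A), (Cmod_mult B), (Cmod_mult K), !(Cmod_mult _ v).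
      apply (Rmult_le_compat_l _ _ _ HA) in T1. apply (Rmult_le_compat_l _ _ _ HB) in T2.
      apply (Rmult_le_compat_l _ _ _ HK) in HRvv.
      assert (HMs : M * s <= eps / 2).
      { apply Rle_trans with (M * (eps / (2 * M))); [apply Rmult_le_compat_l; lra|].
        right; field; lra. }
      assert (HKe : (Cmod K + 1) * e1 = eps / 2) by (unfold e1; field; lra).
      unfold M in HMs. nra. }
  pose proof (is_RInt_plus _ _ _ _ _ _ HI (is_RInt_Re_Cexp_opp (K * c) x)) as HS.
  match type of HS with is_RInt _ _ _ ?v => replace v with (2 * PI * Re (B * c + K * d)%C) in HS end.
  - revert HS. apply is_RInt_ext. intros y _.
    change (Re (W (x, y)) + Re (K * c * Cexp (- (x, y)%R))%C = Re (omega (Cexp (x, y)) * P (x, y))%C).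
    rewrite <- re_plus. f_equal. unfold W. ring.
  - change (2 * PI * Re (B * c + K * d)%C = 2 * PI * Re (B * c + K * d)%C + 0). ring.
Qed.

(** * The Schwarz-Pick bound on two coefficients *)

Lemma Cmod2_plus (a b : C) :
  Cmod (a + b)%C ^ 2 = Cmod a ^ 2 + Cmod b ^ 2 + 2 * Re (a * Cconj b)%C.
Proof. rewrite !Cmod2_alt. unfold Re, Im; simpl. ring. Qed.

Lemma Re_mult_le (h q p : C) : Cmod h <= 1 ->
  2 * Re (h * (q * Cconj p))%C <= Cmod q ^ 2 + Cmod p ^ 2.
Proof.
  intros Hh. pose proof (re_le_Cmod (h * (q * Cconj p))%C) as H.
  rewrite !Cmod_mult, Cmod_conj in H.
  pose proof (Rle_abs (Re (h * (q * Cconj p))%C)).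
  pose proof (Cmod_ge_0 h). pose proof (Cmod_ge_0 q). pose proof (Cmod_ge_0 p).
  assert (Cmod h * (Cmod q * Cmod p) <= 1 * (Cmod q * Cmod p))
    by (apply Rmult_le_compat_r; [apply Rmult_le_pos; assumption|assumption]).
  pose proof (pow2_ge_0 (Cmod q - Cmod p)). nra.
Qed.

(** On [|z| = r] put [u = r / z], [q = q0 u + q1] and [p = p1 + p2 / u].  Integrating
    [2 Re (omega q conj(p)) <= |q|^2 + |p|^2] over the circle, the left side is
    evaluated by [circle_mean]; on the right the cross terms, multiples of [u],
    have mean zero. *)
Lemma toeplitz_bilinear_bound (omega omega' : C -> C) (c d q0 q1 p1 p2 : C) (r : R) :
  (forall z, in_disc z -> cder omega z (omega' z)) ->
  (forall z, in_disc z -> exists l, cder omega' z l) ->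
  (forall z, in_disc z -> in_disc (omega z)) ->
  omega 0 = 0 -> omega' 0 = c -> cder omega' 0 (RtoC 2 * d)%C ->
  0 < r < 1 ->
  2 * Re (RtoC r * c * (q0 * Cconj p1 + q1 * Cconj p2) + RtoC (r ^ 2) * d * (q0 * Cconj p2))%C
    <= Cmod q0 ^ 2 + Cmod q1 ^ 2 + Cmod p1 ^ 2 + Cmod p2 ^ 2.
Proof.
  intros Homega Homega' Hdisc H0 Hc Hd Hr.
  set (x := ln r).
  assert (Hx : x < 0) by (rewrite <- ln_1; apply ln_increasing; lra).
  assert (Hex : exp x = r) by (apply exp_ln; lra).
  set (S := Cmod q0 ^ 2 + Cmod q1 ^ 2 + Cmod p1 ^ 2 + Cmod p2 ^ 2).
  set (k := (q0 * Cconj q1 + p1 * Cconj p2)%C).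
  pose proof (circle_mean omega omega' c d (q1 * Cconj p1)
    (RtoC r * (q0 * Cconj p1 + q1 * Cconj p2)) (RtoC (r ^ 2) * (q0 * Cconj p2)) x
    Homega Homega' H0 Hc Hd Hx) as HI.
  pose proof (is_RInt_Re_Cexp_opp (RtoC r * k) x) as HJ.
  pose proof (is_RInt_const (V := R_NormedModule) 0 (2 * PI) S) as HS.
  pose proof (is_RInt_plus _ _ _ _ _ _ HS (is_RInt_scal _ _ _ 2 _ HJ)) as HK.
  pose proof (is_RInt_scal _ _ _ 2 _ HI) as HI2.
  pose proof PI_RGT_0 as HPI.
  assert (Hle := is_RInt_le _ _ 0 (2 * PI) _ _ ltac:(lra) HI2 HK).
  assert (HL : 2 * (2 * PI * Re (RtoC r * (q0 * Cconj p1 + q1 * Cconj p2) * c +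
                    RtoC (r ^ 2) * (q0 * Cconj p2) * d)%C) <= 2 * PI * S).
  { eapply Rle_trans; [apply Hle|].
    - intros y _.
      set (z := Cexp (x, y)). set (v := Cexp (- (x, y)%R)).
      set (u := (RtoC r * v)%C).
      assert (Hz : in_disc z) by (apply in_disc_Cexp; exact Hx).
      assert (Hu : Cmod u = 1).
      { unfold u, v. rewrite Cmod_mult, Cmod_R, Cmod_Cexp, Rabs_pos_eq by lra. simpl.
        rewrite <- Hex at 1. rewrite <- exp_plus, Rplus_opp_r. apply exp_0. }
      set (q := (q0 * u + q1)%C). set (p := (p1 + p2 * Cconj u)%C).
      assert (Hq : Cmod q ^ 2 = Cmod q0 ^ 2 + Cmod q1 ^ 2 + 2 * Re (q0 * Cconj q1 * u)%C).
      { unfold q. rewrite Cmod2_plus, Cmod_mult, Hu, Rmult_1_r. do 3 f_equal. ring. }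
      assert (Hp : Cmod p ^ 2 = Cmod p1 ^ 2 + Cmod p2 ^ 2 + 2 * Re (p1 * Cconj p2 * u)%C).
      { unfold p. rewrite Cmod2_plus, Cmod_mult, Cmod_conj, Hu, Rmult_1_r, Cmult_conj, Cconj_conj.
        do 3 f_equal. ring. }
      pose proof (Re_mult_le (omega z) q p (Rlt_le _ _ (Hdisc z Hz))) as Hpt.
      rewrite Hq, Hp in Hpt.
      change (2 * Re (omega z * (q1 * Cconj p1 + RtoC r * (q0 * Cconj p1 + q1 * Cconj p2) * v
         + RtoC (r ^ 2) * (q0 * Cconj p2) * (v * v)))%C <= S + 2 * Re (RtoC r * k * v)%C).
      replace (q1 * Cconj p1 + RtoC r * (q0 * Cconj p1 + q1 * Cconj p2) * v
         + RtoC (r ^ 2) * (q0 * Cconj p2) * (v * v))%C with (q * Cconj p)%C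
        by (unfold q, p; rewrite Cplus_conj, Cmult_conj, Cconj_conj, RtoC_pow; unfold u; ring).
      replace (RtoC r * k * v)%C with (q0 * Cconj q1 * u + p1 * Cconj p2 * u)%C
        by (unfold k, u; ring).
      rewrite re_plus. unfold S. lra.
    - right. change ((2 * PI - 0) * S + 2 * 0 = 2 * PI * S). ring. }
  apply Rmult_le_reg_l with (2 * PI); [lra|].
  eapply Rle_trans; [|exact HL]. right.
  replace (RtoC r * c * (q0 * Cconj p1 + q1 * Cconj p2) + RtoC (r ^ 2) * d * (q0 * Cconj p2))%C
    with (RtoC r * (q0 * Cconj p1 + q1 * Cconj p2) * c + RtoC (r ^ 2) * (q0 * Cconj p2) * d)%C
    by ring.
  ring.
Qed.

(** The bilinear bound is applied with [(p1, p2)] the image of [(q0, q1)] under the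
    Toeplitz matrix; its left side is then twice the squared norm of the image. *)
Lemma toeplitz_contraction (omega omega' : C -> C) (c d q0 q1 : C) (r : R) :
  (forall z, in_disc z -> cder omega z (omega' z)) ->
  (forall z, in_disc z -> exists l, cder omega' z l) ->
  (forall z, in_disc z -> in_disc (omega z)) ->
  omega 0 = 0 -> omega' 0 = c -> cder omega' 0 (RtoC 2 * d)%C ->
  0 < r < 1 ->
  Cmod (RtoC r * c * q0)%C ^ 2 + Cmod (RtoC (r ^ 2) * d * q0 + RtoC r * c * q1)%C ^ 2
    <= Cmod q0 ^ 2 + Cmod q1 ^ 2.
Proof.
  intros Homega Homega' Hdisc H0 Hc Hd Hr.
  set (p1 := (RtoC r * c * q0)%C). set (p2 := (RtoC (r ^ 2) * d * q0 + RtoC r * c * q1)%C).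
  pose proof (toeplitz_bilinear_bound omega omega' c d q0 q1 p1 p2 r
    Homega Homega' Hdisc H0 Hc Hd Hr) as H.
  replace (RtoC r * c * (q0 * Cconj p1 + q1 * Cconj p2) + RtoC (r ^ 2) * d * (q0 * Cconj p2))%C
    with (p1 * Cconj p1 + p2 * Cconj p2)%C in H by (unfold p1, p2; ring).
  rewrite re_plus, (Cmult_comm p1), (Cmult_comm p2), !Re_Cconj_mult in H. lra.
Qed.

(** With [c' = r c] and [d' = r^2 d], the vector [q = (1 - |c'|^2, conj(c') d')] is chosen
    so that its image has second entry exactly [d']; contraction then reads
    [(1 - a) |d'|^2 <= (1 - a)^3] for [a = |c'|^2].  Finally [r] tends to 1. *)
Lemma schwarz_pick_coefficients (omega omega' : C -> C) (c d : C) :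
  (forall z, in_disc z -> cder omega z (omega' z)) ->
  (forall z, in_disc z -> exists l, cder omega' z l) ->
  (forall z, in_disc z -> in_disc (omega z)) ->
  omega 0 = 0 -> omega' 0 = c -> cder omega' 0 (RtoC 2 * d)%C ->
  Cmod d <= 1 - Cmod c ^ 2.
Proof.
  intros Homega Homega' Hdisc H0 Hc Hd.
  pose proof (Cmod_ge_0 c) as Hc0. pose proof (Cmod_ge_0 d) as Hd0.
  assert (Hc1 : forall r, 0 < r < 1 -> (r * Cmod c) ^ 2 <= 1).
  { intros r Hr.
    pose proof (toeplitz_contraction omega omega' c d 0 1 r Homega Homega' Hdisc H0 Hc Hd Hr) as H.
    rewrite !Cmult_0_r, Cplus_0_l, Cmult_1_r, Cmod_0, Cmod_1, Cmod_mult, Cmod_R in H.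
    rewrite Rabs_pos_eq in H by lra. lra. }
  assert (Hr : forall r, 0 < r < 1 -> r ^ 2 * (Cmod d + Cmod c ^ 2) <= 1).
  { intros r Hr.
    set (a := (r * Cmod c) ^ 2).
    assert (Ha : 0 <= a < 1).
    { split; [apply pow2_ge_0|]. unfold a.
      specialize (Hc1 ((1 + r) / 2) ltac:(lra)). nra. }
    set (c' := (RtoC r * c)%C). set (d' := (RtoC (r ^ 2) * d)%C).
    assert (Ec : Cmod c' ^ 2 = a) by (unfold c', a; rewrite Cmod_mult, Cmod_R, Rabs_pos_eq; [reflexivity|lra]).
    assert (Ed : Cmod d' = r ^ 2 * Cmod d)
      by (unfold d'; rewrite Cmod_mult, Cmod_R, Rabs_pos_eq; [reflexivity|apply pow2_ge_0]).
    pose proof (toeplitz_contraction omega omega' c d (RtoC (1 - a)) (Cconj c' * d') r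
      Homega Homega' Hdisc H0 Hc Hd Hr) as H.
    fold c' d' in H.
    replace (d' * RtoC (1 - a) + c' * (Cconj c' * d'))%C with d' in H.
    2:{ transitivity (d' * (RtoC (1 - a) + c' * Cconj c'))%C; [|ring].
        rewrite <- Cmod2_conj, Ec, <- RtoC_plus. replace (1 - a + a) with 1 by ring. ring. }
    rewrite !Cmod_mult, Cmod_conj, Cmod_R, (Rabs_pos_eq (1 - a)) in H by lra.
    rewrite !Rpow_mult_distr, Ec in H.
    replace (r ^ 2 * (Cmod d + Cmod c ^ 2)) with (Cmod d' + a) by (rewrite Ed; unfold a; ring).
    pose proof (Cmod_ge_0 d') as Hd'.
    assert (Cmod d' ^ 2 <= (1 - a) ^ 2) by nra. nra. }
  apply Rnot_lt_le. intros Hlt.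
  set (s := Cmod d + Cmod c ^ 2) in *. assert (Hs : 1 < s) by (unfold s; lra).
  assert (Hi : 0 < 1 / s < 1).
  { split; [apply Rdiv_lt_0_compat; lra|]. apply Rmult_lt_reg_r with s; [lra|].
    replace (1 / s * s) with 1 by (field; lra). lra. }
  (* The midpoint of 1/s and 1 exceeds 1/sqrt s by the inequality of the means. *)
  specialize (Hr ((1 + 1 / s) / 2) ltac:(lra)).
  assert (E : ((1 + 1 / s) / 2) ^ 2 * s = 1 + (1 - 1 / s) ^ 2 * s / 4) by (field; lra).
  rewrite E in Hr.
  assert (0 < (1 - 1 / s) ^ 2 * s) by (apply Rmult_lt_0_compat; [apply pow_lt|]; lra).
  lra.
Qed.

(** * The bounds for the determinant *)

Lemma in_disc_0 : in_disc 0.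
Proof. unfold in_disc. rewrite Cmod_0. lra. Qed.

Lemma Cpower_series_unique (a : nat -> C) (z s : C) :
  disc_coefficients a -> in_disc z -> Cseries (fun n => a n * z ^ n)%C s ->
  Cpower_series a z = s.
Proof.
  intros Ha Hz Hs. exact (Cseries_unique _ _ _ (Cpower_series_correct a z Ha Hz) Hs).
Qed.

Lemma cder_Cpower_series (a : nat -> C) (z : C) :
  disc_coefficients a -> in_disc z ->
  cder (Cpower_series a) z (Cpower_series (Cderive_coefficients a) z).
Proof.
  intros Ha Hz. apply (cder_power_series a); try assumption.
  - intros w Hw. apply Cpower_series_correct; assumption.
  - apply Cpower_series_correct; [apply disc_coefficients_derive|]; assumption.
Qed.

Lemma Cpower_series_0 (a : nat -> C) : disc_coefficients a -> Cpower_series a 0 = a 0%nat.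
Proof.
  intros Ha. apply Cpower_series_unique; [exact Ha|exact in_disc_0|].
  replace (a 0%nat) with (RtoC 0 * a 0%nat + a 0%nat * 0 ^ 0)%C by (simpl; ring).
  apply (Cseries_shift (fun n => a n * 0 ^ n)%C).
  replace (RtoC 0 * a 0%nat)%C with (RtoC 0 * Cpower_series a 0)%C by ring.
  eapply Cseries_ext; [|apply Cseries_scal, (Cpower_series_correct a 0 Ha in_disc_0)].
  intros n. simpl. ring.
Qed.

(** Here [omega] is only known to be differentiable.  The relation
    [Cexp (omega z) = 1 + z F'(z)] transfers the smoothness of the power series [F] to
    [omega], and differentiating it twice at 0 yields the coefficients of [omega]. *)
Lemma subordinate_coefficient_bound (f : C -> C) (gamma : nat -> C) :
  class_S_e f -> log_coefficients f gamma ->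
  Cmod (4 * gamma 2%nat - 2 * (gamma 1%nat * gamma 1%nat))%C <= 1 - Cmod (2 * gamma 1%nat)%C ^ 2.
Proof.
  intros [[Hf [_ [Hf0 _]]] [omega [Hoa [Hod [Ho0 Hsub]]]]] [F [_ [_ [HFexp HFs]]]].
  (* The entry gamma 0 is unconstrained, and the constant term of F is 0. *)
  set (a := fun n => match n with O => RtoC 0 | S k => (RtoC 2 * gamma (S k))%C end).
  assert (HaF : forall z, in_disc z -> Cseries (fun n => a n * z ^ n)%C (F z)).
  { intros z Hz. replace (F z) with (F z + a 0%nat * z ^ 0)%C by (simpl; ring).
    apply (Cseries_shift (fun n => a n * z ^ n)%C).
    eapply Cseries_ext; [|exact (HFs z Hz)]. intros n. unfold a. ring. }
  pose proof (disc_coefficients_of_series a F HaF) as Ha.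
  pose proof (disc_coefficients_derive _ Ha) as Ha1.
  pose proof (disc_coefficients_derive _ Ha1) as Ha2.
  set (F1 := Cpower_series (Cderive_coefficients a)).
  set (F2 := Cpower_series (Cderive_coefficients (Cderive_coefficients a))).
  set (F3 := Cpower_series (Cderive_coefficients (Cderive_coefficients (Cderive_coefficients a)))).
  assert (HF1 : forall z, in_disc z -> cder F z (F1 z)).
  { intros z Hz. apply (cder_power_series a); try assumption.
    apply Cpower_series_correct; assumption. }
  assert (HF2 : forall z, in_disc z -> cder F1 z (F2 z))
    by (intros; apply cder_Cpower_series; assumption).
  assert (HF3 : forall z, in_disc z -> cder F2 z (F3 z))
    by (intros; apply cder_Cpower_series; assumption).
  set (p := fun z => (1 + z * F1 z)%C).
  set (p1 := fun z => (F1 z + z * F2 z)%C).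
  set (p2 := fun z => (F2 z + (F2 z + z * F3 z))%C).
  assert (Hp : forall z, in_disc z -> cder p z (p1 z)).
  { intros z Hz. eapply cder_eq.
    - apply cder_plus; [apply cder_const|apply (cder_mult (fun w => w)); [apply cder_id|apply HF2, Hz]].
    - unfold p1; ring. }
  assert (Hp1 : forall z, in_disc z -> cder p1 z (p2 z)).
  { intros z Hz. eapply cder_eq.
    - apply cder_plus; [apply HF2, Hz|apply (cder_mult (fun w => w)); [apply cder_id|apply HF3, Hz]].
    - unfold p2; ring. }
  assert (HfF : forall z, in_disc z -> (z * Cexp (F z))%C = f z).
  { intros z Hz. destruct (Ceq_dec z 0) as [->|Hz0]; [rewrite Hf0; ring|].
    rewrite (HFexp z Hz Hz0). field. exact Hz0. }
  assert (Hop : forall z, in_disc z -> Cexp (omega z) = p z).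
  { intros z Hz. rewrite <- (Hsub z Hz). unfold log_deriv_quotient.
    destruct (Ceq_dec z 0) as [->|Hz0]; [unfold p; ring|].
    assert (HD : cder f z (Cexp (F z) * p z)%C).
    { apply (cder_ext_disc (fun w => w * Cexp (F w))%C); [exact Hz|exact HfF|].
      eapply cder_eq.
      - apply (cder_mult (fun w => w)); [apply cder_id|].
        apply (cder_comp Cexp); [apply cder_Cexp|apply HF1, Hz].
      - unfold p; ring. }
    rewrite (is_C_derive_unique f z _ (proj1 (cder_C_NormedModule _ _ _) HD)).
    rewrite <- (HfF z Hz). field. split; [apply Cexp_neq_0|exact Hz0]. }
  set (omega1 := fun z => (p1 z * Cexp (- omega z))%C).
  assert (Ho : forall z, in_disc z -> cder omega z (omega1 z)).
  { intros z Hz.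
    assert (Hex : exists l : C, cder omega z l)
      by (destruct (Hoa z Hz) as [l Hl]; exists l; apply cder_C_NormedModule, Hl).
    destruct Hex as [l Hl].
    replace (omega1 z) with l; [exact Hl|].
    assert (E : (Cexp (omega z) * l)%C = p1 z).
    { apply (cder_unique p z); [|apply Hp, Hz].
      apply (cder_ext_disc (fun w => Cexp (omega w))); [exact Hz|exact Hop|].
      apply (cder_comp Cexp); [apply cder_Cexp|exact Hl]. }
    unfold omega1. rewrite <- E.
    transitivity (Cexp (omega z) * Cexp (- omega z) * l)%C; [rewrite Cexp_opp; ring|ring]. }
  assert (Ho1 : forall z, in_disc z -> cder omega1 z
     (p2 z * Cexp (- omega z) + p1 z * (- Cexp (- omega z) * omega1 z))%C).
  { intros z Hz. apply (cder_mult p1 (fun w => Cexp (- omega w))); [apply Hp1, Hz|].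
    apply (cder_comp (fun w => Cexp (- w)) omega); [apply (cder_Cexp_opp (omega z))|apply Ho, Hz]. }
  assert (HF10 : F1 0 = (2 * gamma 1%nat)%C).
  { unfold F1. rewrite Cpower_series_0 by assumption.
    unfold Cderive_coefficients, a. simpl. ring. }
  assert (HF20 : F2 0 = (4 * gamma 2%nat)%C).
  { unfold F2. rewrite Cpower_series_0 by assumption.
    unfold Cderive_coefficients, a. simpl INR.
    replace (RtoC (1 + 1)) with (RtoC 2) by reflexivity. ring. }
  apply (schwarz_pick_coefficients omega omega1); try assumption.
  - intros z Hz. eexists. apply Ho1, Hz.
  - unfold omega1, p1. rewrite Ho0, HF10.
    replace (- RtoC 0)%C with (RtoC 0) by ring. rewrite Cexp_0. ring.
  - eapply cder_eq; [apply Ho1, in_disc_0|].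
    unfold omega1, p1, p2. rewrite Ho0, HF10, HF20.
    replace (- RtoC 0)%C with (RtoC 0) by ring. rewrite Cexp_0.
    ring.
Qed.

(** For [t > 15/16] the upper bound needs the lower estimate of [|gamma_2|]; for
    smaller [t] already [t / 4] is at most [15 / 64]. *)
Lemma T21_bounds (f : C -> C) (gamma : nat -> C) :
  class_S_e f -> log_coefficients f gamma -> Im (gamma 1%nat) = 0 ->
  - (1 / 16) <= T21 gamma <= 15 / 64.
Proof.
  intros Hf Hg Hreal. pose proof (subordinate_coefficient_bound f gamma Hf Hg) as H.
  unfold T21. set (g := Re (gamma 1%nat)).
  assert (Eg : gamma 1%nat = RtoC g).
  { rewrite (surjective_pairing (gamma 1%nat)). unfold Im in Hreal. rewrite Hreal. reflexivity. }
  rewrite Eg in H. set (m := Cmod (gamma 2%nat)).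
  set (t := 4 * g ^ 2).
  rewrite <- !RtoC_mult, Cmod_R, pow2_abs in H.
  replace ((2 * g) ^ 2) with t in H by (unfold t; ring).
  replace (2 * (g * g)) with (t / 2) in H by (unfold t; field).
  assert (Ht : 0 <= t) by (unfold t; pose proof (pow2_ge_0 g); lra).
  assert (Hm0 : 0 <= m) by apply Cmod_ge_0.
  assert (E4 : Cmod (4 * gamma 2%nat)%C = 4 * m) by (rewrite Cmod_mult, Cmod_R, Rabs_pos_eq by lra; reflexivity).
  assert (Et : Cmod (RtoC (t / 2)) = t / 2) by (rewrite Cmod_R, Rabs_pos_eq; lra).
  assert (Hup : 4 * m <= 1 - t / 2).
  { rewrite <- E4. replace (4 * gamma 2%nat)%C with ((4 * gamma 2%nat - RtoC (t / 2)) + RtoC (t / 2))%C by ring.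
    eapply Rle_trans; [apply Cmod_triangle|]. lra. }
  assert (Hlow : 3 / 2 * t - 1 <= 4 * m).
  { pose proof (Cmod_triangle (4 * gamma 2%nat)%C (- (4 * gamma 2%nat - RtoC (t / 2)))%C) as HT.
    rewrite Cmod_opp, E4 in HT.
    replace (4 * gamma 2%nat + - (4 * gamma 2%nat - RtoC (t / 2)))%C with (RtoC (t / 2)) in HT by ring.
    lra. }
  pose proof (Cmod_ge_0 (4 * gamma 2%nat - RtoC (t / 2))%C).
  replace (g ^ 2) with (t / 4) by (unfold t; field).
  split; [nra|].
  destruct (Rle_lt_dec t (15 / 16)); [nra|].
  assert ((3 / 2 * t - 1) ^ 2 <= (4 * m) ^ 2) by (apply pow_incr; lra). nra.
Qed.

(** * Univalence from the starlikeness condition *)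

Lemma unit_circle_angle (x y : R) : x ^ 2 + y ^ 2 = 1 -> exists t, cos t = x /\ sin t = y.
Proof.
  intros H. assert (Hx : -1 <= x <= 1) by nra.
  assert (Hs : sin (acos x) = Rabs y).
  { rewrite sin_acos by exact Hx. replace (1 - Rsqr x) with (Rsqr y) by (unfold Rsqr; lra).
    apply sqrt_Rsqr_abs. }
  destruct (Rle_lt_dec 0 y) as [Hy|Hy].
  - exists (acos x). rewrite cos_acos, Hs, Rabs_pos_eq by assumption. auto.
  - exists (- acos x). rewrite cos_neg, sin_neg, cos_acos, Hs, Rabs_left by assumption.
    split; ring.
Qed.

Lemma Cexp_surjective (z : C) : z <> 0 -> exists w, Cexp w = z.
Proof.
  intros Hz. pose proof (proj1 (Cmod_gt_0 z) Hz) as Hm.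
  set (m := Cmod z) in *.
  destruct (unit_circle_angle (Re z / m) (Im z / m)) as [t [Hc Hs]].
  { replace ((Re z / m) ^ 2 + (Im z / m) ^ 2) with ((Re z ^ 2 + Im z ^ 2) / m ^ 2) by (field; lra).
    rewrite <- Cmod2_alt. fold m. field. lra. }
  exists (ln m, t). unfold Cexp. simpl Re. simpl Im. rewrite exp_ln, Hc, Hs by exact Hm.
  rewrite (surjective_pairing z) at 3. unfold Re, Im. f_equal; field; lra.
Qed.

Lemma disc_logarithm (z : C) : in_disc z -> z <> 0 -> exists w, Re w < 0 /\ Cexp w = z.
Proof.
  intros Hz Hz0. destruct (Cexp_surjective z Hz0) as [w Hw]. exists w. split; [|exact Hw].
  apply exp_lt_inv. rewrite <- Cmod_Cexp, Hw, exp_0. exact Hz.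
Qed.

(** The Noshiro-Warschawski argument: along the segment from [z] to [w], the component
    of [H] in the direction [w - z] increases strictly. *)
Lemma injective_of_Re_derivative_pos (H H' : C -> C) (z w : C) :
  (forall u, Re u < 0 -> cder H u (H' u)) ->
  (forall u, Re u < 0 -> 0 < Re (H' u)) ->
  Re z < 0 -> Re w < 0 -> H z = H w -> z = w.
Proof.
  intros HD Hpos Hz Hw E.
  assert (Hseg : forall t, 0 <= t <= 1 -> Re (z + RtoC t * (w - z))%C < 0).
  { intros t Ht. unfold Re in *; simpl. nra. }
  destruct (Re_mean_value H H' z w (Cconj (w - z))) as [t [Ht Em]].
  { intros t Ht. apply HD, Hseg, Ht. }
  rewrite E in Em. set (l := H' (z + RtoC t * (w - z))%C) in *.
  assert (Hl : 0 < Re l) by apply Hpos, Hseg, Ht.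
  assert (E2 : Re (Cconj (w - z) * (l * (w - z)))%C = Cmod (w - z)%C ^ 2 * Re l).
  { rewrite Cmod2_alt. unfold Re, Im; simpl. ring. }
  rewrite E2 in Em.
  replace (Cconj (w - z) * (H w - H w))%C with (RtoC 0) in Em by ring.
  simpl (Re 0) in Em. symmetry in Em. apply Rmult_integral in Em.
  assert (H0 : Cmod (w - z)%C = 0).
  { destruct Em as [Em|Em]; [|lra].
    destruct (Req_dec (Cmod (w - z)%C) 0) as [D|D]; [exact D|].
    exfalso. exact (pow_nonzero _ 2 D Em). }
  apply Cmod_eq_0 in H0.
  replace z with (w - (w - z))%C by ring. rewrite H0. ring.
Qed.

(** Write [z = Cexp a], [w = Cexp b] with [a], [b] in the left half-plane and let
    [H u = u + F (Cexp u)], so that [f o Cexp = Cexp o H].  If [f z = f w], then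
    [k = H a - H b] is a period of [Cexp], whence [H (b + k) = H b + k = H a].
    Injectivity of [H] gives [a = b + k], and so [z = w]. *)
Lemma starlike_univalent (F F1 : C -> C) :
  (forall z, in_disc z -> cder F z (F1 z)) ->
  (forall z, in_disc z -> 0 < Re (1 + z * F1 z)%C) ->
  univalent_on_disc (fun z => z * Cexp (F z))%C.
Proof.
  intros HF Hpos z w Hz Hw E.
  assert (Hzero : forall u v : C, u = 0 -> (u * Cexp (F u))%C = (v * Cexp (F v))%C -> u = v).
  { intros u v -> Ev. destruct (Ceq_dec v 0) as [->|Hv]; [reflexivity|].
    exfalso. rewrite Cmult_0_l in Ev.
    apply (Cmult_neq_0 v (Cexp (F v)) Hv (Cexp_neq_0 _)). symmetry. exact Ev. }
  destruct (Ceq_dec z 0) as [Hz0|Hz0]; [apply Hzero; assumption|].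
  destruct (Ceq_dec w 0) as [Hw0|Hw0]; [symmetry; apply Hzero; [|symmetry]; assumption|].
  destruct (disc_logarithm z Hz Hz0) as [a [Ha Ea]].
  destruct (disc_logarithm w Hw Hw0) as [b [Hb Eb]].
  set (H := fun u => (u + F (Cexp u))%C).
  set (H' := fun u => (1 + F1 (Cexp u) * Cexp u)%C).
  set (k := (H a - H b)%C).
  assert (EH : forall u, Cexp (H u) = (Cexp u * Cexp (F (Cexp u)))%C)
    by (intros; apply Cexp_plus).
  assert (Ek : Cexp k = 1).
  { unfold k, Cminus. rewrite Cexp_plus, EH, Ea, E, <- Eb, <- EH. apply Cexp_opp. }
  assert (Rk : Re k = 0).
  { apply exp_inv. rewrite <- Cmod_Cexp, Ek, exp_0. apply Cmod_1. }
  assert (Eb' : Cexp (b + k) = w) by (rewrite Cexp_plus, Ek, Eb; ring).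
  rewrite <- Ea, <- Eb'. f_equal.
  apply (injective_of_Re_derivative_pos H H').
  - intros u Hu. apply cder_plus; [apply cder_id|].
    apply cder_comp; [apply HF, in_disc_Cexp, Hu|apply cder_Cexp].
  - intros u Hu. unfold H'. rewrite Cmult_comm. apply Hpos, in_disc_Cexp, Hu.
  - exact Ha.
  - rewrite re_plus, Rk. lra.
  - unfold H. rewrite Eb', <- Eb. transitivity (H b + k)%C; [unfold k, H; ring|unfold H; ring].
Qed.

(** * Functions given by their logarithmic derivative *)

Lemma class_S_e_of_log_derivative (F F1 omega omega1 : C -> C) :
  (forall z, in_disc z -> cder F z (F1 z)) -> F 0 = 0 ->
  (forall z, in_disc z -> (1 + z * F1 z)%C = Cexp (omega z)) ->
  (forall z, in_disc z -> cder omega z (omega1 z)) ->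
  (forall z, in_disc z -> in_disc (omega z)) -> omega 0 = 0 ->
  class_S_e (fun z => z * Cexp (F z))%C.
Proof.
  intros HF HF0 Hp Ho Hod Ho0.
  assert (HD : forall z, in_disc z ->
    cder (fun z => z * Cexp (F z))%C z (Cexp (F z) * (1 + z * F1 z))%C).
  { intros z Hz. eapply cder_eq.
    - apply (cder_mult (fun w => w)); [apply cder_id|].
      apply (cder_comp Cexp); [apply cder_Cexp|apply HF, Hz].
    - cbv beta; ring. }
  assert (HC : forall z, in_disc z ->
    C_derive (fun z => z * Cexp (F z))%C z = (Cexp (F z) * (1 + z * F1 z))%C).
  { intros z Hz. apply is_C_derive_unique, cder_C_NormedModule, HD, Hz. }
  split; [split; [|split; [|split]]|].
  - intros z Hz. eexists. apply cder_C_NormedModule, HD, Hz.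
  - apply (starlike_univalent F F1); [exact HF|].
    intros z Hz. rewrite Hp by exact Hz. apply Re_Cexp_pos, Hod, Hz.
  - ring.
  - rewrite HC by exact in_disc_0. rewrite HF0, Cexp_0. ring.
  - exists omega. split; [|split; [exact Hod|split; [exact Ho0|]]].
    + intros z Hz. eexists. apply cder_C_NormedModule, Ho, Hz.
    + intros z Hz. rewrite <- Hp by exact Hz. unfold log_deriv_quotient.
      destruct (Ceq_dec z 0) as [->|Hz0]; [ring|].
      rewrite HC by exact Hz. field. split; [apply Cexp_neq_0|exact Hz0].
Qed.

Lemma log_coefficients_of_series (F F1 : C -> C) (gamma : nat -> C) :
  (forall z, in_disc z -> cder F z (F1 z)) -> F 0 = 0 ->
  (forall z, in_disc z -> Cseries (fun n => 2 * (gamma (S n) * z ^ S n))%C (F z)) ->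
  log_coefficients (fun z => z * Cexp (F z))%C gamma.
Proof.
  intros HF HF0 HS. exists F. split; [|split; [exact HF0|split; [|exact HS]]].
  - intros z Hz. eexists. apply cder_C_NormedModule, HF, Hz.
  - intros z Hz Hz0. field. exact Hz0.
Qed.

(** * The exponential series and its logarithmic primitive *)

Lemma INR_fact_ge_1 (n : nat) : 1 <= INR (fact n).
Proof. apply (le_INR 1). pose proof (lt_O_fact n). lia. Qed.

Lemma Cmod_inv_le_1 (x : R) : 1 <= x -> Cmod (RtoC (/ x)) <= 1.
Proof.
  intros Hx. rewrite Cmod_R, Rabs_pos_eq by (left; apply Rinv_0_lt_compat; lra).
  rewrite <- Rinv_1. apply Rinv_le_contravar; lra.
Qed.

Definition exp_coefficients (n : nat) : C := RtoC (/ INR (fact n)).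

Lemma disc_coefficients_exp : disc_coefficients exp_coefficients.
Proof. apply disc_coefficients_bounded. intros n. apply Cmod_inv_le_1, INR_fact_ge_1. Qed.

(** The power series [E] with coefficients [1/n!] satisfies [E' = E], so
    [E z * Cexp (- z)] has zero derivative and keeps its value 1 at 0. *)
Lemma Cseries_Cexp (z : C) : in_disc z -> Cseries (fun n => exp_coefficients n * z ^ n)%C (Cexp z).
Proof.
  intros Hz. pose proof disc_coefficients_exp as He.
  assert (Hder : forall w, in_disc w ->
    cder (Cpower_series exp_coefficients) w (Cpower_series exp_coefficients w)).
  { intros w Hw. apply (cder_power_series exp_coefficients); [exact He| |exact Hw|].
    - intros; apply Cpower_series_correct; assumption.
    - eapply Cseries_ext; [|apply Cpower_series_correct; assumption].
      intros n. unfold Cderive_coefficients, exp_coefficients. rewrite <- RtoC_mult.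
      do 2 f_equal. rewrite fact_simpl, mult_INR. field.
      split; [apply INR_fact_neq_0|apply not_0_INR; lia]. }
  set (g := fun w => (Cpower_series exp_coefficients w * Cexp (- w))%C).
  assert (Hg : Cmod (g z - g 0)%C <= 0 * Cmod (z - 0)%C).
  { apply (mean_value_inequality g (fun _ => RtoC 0)). intros t Ht.
    split; [|rewrite Cmod_0; lra].
    eapply cder_eq; [apply cder_mult; [apply Hder|apply cder_Cexp_opp]|cbv beta; ring].
    apply in_disc_segment; [exact in_disc_0|exact Hz|exact Ht]. }
  assert (E : g z = 1).
  { rewrite Rmult_0_l in Hg. pose proof (Cmod_ge_0 (g z - g 0)%C).
    assert (E0 : (g z - g 0 = 0)%C) by (apply Cmod_eq_0; lra).
    assert (E1 : g 0 = 1).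
    { unfold g. rewrite Cpower_series_0 by exact He.
      replace (- RtoC 0)%C with (RtoC 0) by ring. rewrite Cexp_0.
      unfold exp_coefficients. simpl. rewrite Rinv_1. ring. }
    replace (g z) with (g z - g 0 + g 0)%C by ring. rewrite E0, E1. ring. }
  replace (Cexp z) with (Cpower_series exp_coefficients z).
  - apply Cpower_series_correct; assumption.
  - transitivity (g z * Cexp z)%C; [|rewrite E; ring].
    unfold g. transitivity (Cpower_series exp_coefficients z * (Cexp z * Cexp (- z)))%C;
      [rewrite Cexp_opp; ring|ring].
Qed.

Definition ein_coefficients (n : nat) : C :=
  match n with O => RtoC 0 | S _ => RtoC (/ (INR n * INR (fact n))) end.

(** The entire function [sum_(n >= 1) z^n / (n n!)], that is the primitive of
    [(e^z - 1) / z] vanishing at 0, an exponential integral. *)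
Definition Cein : C -> C := Cpower_series ein_coefficients.
Definition Cein' : C -> C := Cpower_series (Cderive_coefficients ein_coefficients).

Lemma disc_coefficients_ein : disc_coefficients ein_coefficients.
Proof.
  apply disc_coefficients_bounded. intros [|n]; [simpl; rewrite Cmod_0; lra|].
  apply Cmod_inv_le_1. pose proof (INR_fact_ge_1 (S n)).
  pose proof (le_INR 1 (S n) ltac:(lia)) as H1. change (INR 1) with 1 in H1. nra.
Qed.

Lemma Cein_0 : Cein 0 = 0.
Proof. exact (Cpower_series_0 _ disc_coefficients_ein). Qed.

Lemma cder_Cein (z : C) : in_disc z -> cder Cein z (Cein' z).
Proof. apply cder_Cpower_series, disc_coefficients_ein. Qed.

Lemma Cein'_eq (z : C) : in_disc z -> (1 + z * Cein' z)%C = Cexp z.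
Proof.
  intros Hz. apply (Cseries_unique (fun n => exp_coefficients n * z ^ n)%C); [|apply Cseries_Cexp, Hz].
  replace (1 + z * Cein' z)%C with (z * Cein' z + exp_coefficients 0 * z ^ 0)%C
    by (unfold exp_coefficients; simpl; rewrite Rinv_1; ring).
  apply (Cseries_shift (fun n => exp_coefficients n * z ^ n)%C).
  eapply Cseries_ext; [|apply Cseries_scal, Cpower_series_correct;
    [apply disc_coefficients_derive, disc_coefficients_ein|exact Hz]].
  intros n. unfold Cderive_coefficients, ein_coefficients, exp_coefficients.
  rewrite <- RtoC_mult.
  replace (INR (S n) * / (INR (S n) * INR (fact (S n)))) with (/ INR (fact (S n)))
    by (field; split; [apply INR_fact_neq_0|apply not_0_INR; lia]).
  simpl. ring.
Qed.

Lemma Cseries_Cein (z : C) : in_disc z ->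
  Cseries (fun n => ein_coefficients (S n) * z ^ S n)%C (Cein z).
Proof.
  intros Hz. apply (Cseries_drop (fun n => ein_coefficients n * z ^ n)%C); [simpl; ring|].
  apply Cpower_series_correct; [apply disc_coefficients_ein|exact Hz].
Qed.

(** Zeros at the even places turn a series in [z^2] into the shifted coefficient
    pattern of [log_coefficients], where place [n] belongs to [z^(n+1)]. *)
Lemma Cseries_interleave_0 (u : nat -> C) (s : C) :
  Cseries u s -> Cseries (fun n => if Nat.odd n then u (Nat.div2 n) else RtoC 0) s.
Proof.
  intros Hu. set (v := fun n => if Nat.odd n then u (Nat.div2 n) else RtoC 0).
  assert (H : forall n, sum_n v (S n) = sum_n u (Nat.div2 n)).
  { assert (H2 : forall m, sum_n v (S (2 * m)) = sum_n u m /\ sum_n v (S (S (2 * m))) = sum_n u m).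
    { assert (Hodd : forall m, v (S (2 * m)) = u m).
      { intros m. unfold v. rewrite Nat.odd_succ, Nat.even_mul, Nat.div2_succ_double. reflexivity. }
      assert (Heven : forall m, v (2 * m)%nat = 0).
      { intros m. unfold v. rewrite Nat.odd_mul. reflexivity. }
      assert (Hstep : forall m, sum_n v (S (2 * m)) = sum_n u m ->
        sum_n v (S (S (2 * m))) = sum_n u m).
      { intros m Hm. rewrite sum_Sn, Hm.
        replace (S (S (2 * m))) with (2 * S m)%nat by lia. rewrite Heven. exact (Cplus_0_r (sum_n u m)). }
      intros m. induction m as [|m [IH1 IH2]].
      - assert (E : sum_n v (S (2 * 0)) = sum_n u 0).
        { rewrite sum_Sn, !sum_O. rewrite Hodd. change (v 0%nat) with (RtoC 0). exact (Cplus_0_l (u 0%nat)). }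
        split; [exact E|apply Hstep, E].
      - assert (E : sum_n v (S (2 * S m)) = sum_n u (S m)).
        { rewrite sum_Sn, Hodd. replace (2 * S m)%nat with (S (S (2 * m))) by lia.
          rewrite IH2, sum_Sn. reflexivity. }
        split; [exact E|apply Hstep, E]. }
    intros n. rewrite (Nat.div2_odd n) at 1. destruct (Nat.odd n); simpl Nat.b2n.
    - rewrite Nat.add_1_r. apply H2.
    - rewrite Nat.add_0_r. apply H2. }
  apply (filterlim_ext_loc (fun n => sum_n u (Nat.div2 (pred n)))).
  - exists 1%nat. intros [|n] Hn; [lia|]. symmetry. apply H.
  - apply (filterlim_comp _ _ _ (fun n => Nat.div2 (pred n)) (sum_n u) eventually eventually _); [|exact Hu].
    intros P [N HN]. exists (2 * N + 1)%nat. intros n Hn. apply HN.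
    rewrite Nat.div2_div. apply Nat.div_le_lower_bound; lia.
Qed.

(** * The extremal functions *)

Lemma lower_bound_attained :
  exists (f : C -> C) (gamma : nat -> C),
     class_S_e f /\ log_coefficients f gamma /\ Im (gamma 1%nat) = 0 /\
     T21 gamma = - (1 / 16).
Proof.
  set (F := fun z => (/ 2 * Cein (z * z))%C).
  set (F1 := fun z => (/ 2 * (Cein' (z * z) * (1 * z + z * 1)))%C).
  set (gamma := fun n => if Nat.even n then (/ 4 * ein_coefficients (Nat.div2 n))%C else RtoC 0).
  assert (Hsq : forall z, cder (fun w => w * w)%C z (1 * z + z * 1)%C)
    by (intros z; apply (cder_mult (fun w => w) (fun w => w)); apply cder_id).
  assert (Hsqd : forall z, in_disc z -> in_disc (z * z)%C).
  { intros z Hz. unfold in_disc in *. rewrite Cmod_mult. pose proof (Cmod_ge_0 z). nra. }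
  assert (HF : forall z, in_disc z -> cder F z (F1 z)).
  { intros z Hz. apply cder_scal, (cder_comp Cein (fun w => w * w)%C); [|apply Hsq].
    apply cder_Cein, Hsqd, Hz. }
  assert (HF0 : F 0 = 0).
  { unfold F. replace (RtoC 0 * RtoC 0)%C with (RtoC 0) by ring. rewrite Cein_0. ring. }
  exists (fun z => z * Cexp (F z))%C, gamma. split; [|split; [|split]].
  - apply (class_S_e_of_log_derivative F F1 (fun z => z * z)%C (fun z => 1 * z + z * 1)%C); try assumption.
    + intros z Hz. rewrite <- Cein'_eq by (apply Hsqd, Hz). unfold F1.
      field.
    + intros z _. apply Hsq.
    + ring.
  - apply (log_coefficients_of_series F F1); try assumption.
    intros z Hz.
    eapply Cseries_ext; [|apply Cseries_interleave_0, (Cseries_scal (/ 2)), Cseries_Cein, Hsqd, Hz].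
    intros n. cbv beta. unfold gamma. rewrite <- Nat.even_succ.
    destruct (Nat.even (S n)) eqn:E; [|ring].
    apply Nat.even_spec in E. destruct E as [m Hm].
    destruct m as [|m]; [lia|]. replace n with (S (2 * m)) by lia.
    replace (S (S (2 * m))) with (2 * S m)%nat by lia.
    rewrite Nat.div2_succ_double, Nat.div2_double, Cpow_mult_r.
    replace (z ^ 2)%C with (z * z)%C by (simpl; ring).
    field.
  - reflexivity.
  - unfold T21, gamma. simpl Nat.even. cbv iota. simpl Nat.div2.
    unfold ein_coefficients. rewrite <- RtoC_inv, <- RtoC_mult, Cmod_R, pow2_abs by lra.
    simpl. field.
Qed.

Lemma upper_bound_attained :
  exists (f : C -> C) (gamma : nat -> C),
     class_S_e f /\ log_coefficients f gamma /\ Im (gamma 1%nat) = 0 /\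
     T21 gamma = 15 / 64.
Proof.
  exists (fun z => z * Cexp (Cein z))%C, (fun n => / 2 * ein_coefficients n)%C.
  split; [|split; [|split]].
  - apply (class_S_e_of_log_derivative Cein Cein' (fun z => z) (fun _ => RtoC 1)).
    + apply cder_Cein.
    + apply Cein_0.
    + apply Cein'_eq.
    + intros z _. apply cder_id.
    + auto.
    + reflexivity.
  - apply (log_coefficients_of_series Cein Cein').
    + apply cder_Cein.
    + apply Cein_0.
    + intros z Hz. eapply Cseries_ext; [|apply Cseries_Cein, Hz].
      intros n. cbv beta. field.
  - unfold ein_coefficients. rewrite <- RtoC_inv, <- RtoC_mult by lra. reflexivity.
  - unfold T21, ein_coefficients.
    rewrite <- RtoC_inv, <- !RtoC_mult, Cmod_R, pow2_abs by lra. simpl. field.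
Qed.

(** * The sharp bounds *)

Theorem theorem4p1 :
  (forall (f : C -> C) (gamma : nat -> C),
     class_S_e f -> log_coefficients f gamma -> Im (gamma 1%nat) = 0 ->
     - (1 / 16) <= T21 gamma <= 15 / 64) /\
  (exists (f : C -> C) (gamma : nat -> C),
     class_S_e f /\ log_coefficients f gamma /\ Im (gamma 1%nat) = 0 /\
     T21 gamma = - (1 / 16)) /\
  (exists (f : C -> C) (gamma : nat -> C),
     class_S_e f /\ log_coefficients f gamma /\ Im (gamma 1%nat) = 0 /\
     T21 gamma = 15 / 64).
Proof.
  split; [exact T21_bounds|].
  split; [exact lower_bound_attained|exact upper_bound_attained].
Qed.
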